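(* Let $p$ be a prime, let $\mathcal{F}$ be a saturated fusion system over a discrete $p$-toral group $S$, and fix a subgroup $\Omega\le\mathrm{Aut}(\mathcal{F})$. Let $\mathcal{E}_1,\dots,\mathcal{E}_k$ and $\mathcal{E}_1^*,\dots,\mathcal{E}_m^*$ be $\Omega$-indecomposable $\Omega$-invariant fusion subsystems of $\mathcal{F}$ such that $$\mathcal{F}=\mathcal{E}_1\times\cdots\times\mathcal{E}_k=\mathcal{E}_1^*\times\cdots\times\mathcal{E}_m^*.$$ Then $k=m$, and there are $\alpha\in\mathrm{Aut}^\Omega(\mathcal{F})$ and $\sigma\in\Sigma_k$ such that $\alpha(\mathcal{E}_i)=\mathcal{E}^*_{\sigma(i)}$ for each $i$.
   Context: $\mathbb{Z}/p^\infty$ is the union of the chain $\mathbb{Z}/p\le\mathbb{Z}/p^2\le\cdots$ of finite cyclic $p$-groups. A discrete $p$-toral group is a group $S$ with a normal subgroup $S_0$ such that $S_0$ is isomorphic to a finite product of copies of $\mathbb{Z}/p^\infty$ and $S/S_0$ is a finite $p$-group. For $P,Q\le S$, $\mathrm{Inj}(P,Q)$ is the set of injective homomorphisms $P\to Q$, $\mathrm{Hom}_S(P,Q)$ is the set of homomorphisms $P\to Q$ of the form $x\mapsto c_g(x)=gxg^{-1}$ with $g\in S$, and $\mathrm{Aut}_S(P)=\mathrm{Hom}_S(P,P)\cap\mathrm{Aut}(P)$. A fusion system $\mathcal{F}$ over $S$ is a category whose objects are the subgroups of $S$, with $\mathrm{Hom}_S(P,Q)\subseteq\mathrm{Hom}_{\mathcal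 F}(P,Q)\subseteq\mathrm{Inj}(P,Q)$ for all $P,Q\le S$, and such that every morphism in $\mathcal F$ factors as an isomorphism in $\mathcal F$ followed by an inclusion. Subgroups $P,P'$ are $\mathcal F$-conjugate if they are isomorphic in $\mathcal F$; $P^{\mathcal F}$ is the conjugacy class of $P$. $P\le S$ is fully automized if the index of $\mathrm{Aut}_S(P)$ in $\mathrm{Aut}_{\mathcal F}(P)$ is finite and prime to $p$; $P$ is receptive if for each $Q\in P^{\mathcal F}$ and each isomorphism $\varphi\in\mathrm{Iso}_{\mathcal F}(Q,P)$, $\varphi$ extends to some $\bar\varphi\in\mathrm{Hom}_{\mathcal F}(N_\varphi,S)$, where $N_\varphi=\{g\in N_S(Q)\mid \varphi c_g\varphi^{-1}\in\mathrm{Aut}_S(P)\}$. $\mathcal F$ is saturated if (i) each $P\le S$ is $\mathcal F$-conjugate to a subgroup that is fully automized and receptive; and (ii) whenever $P_1\le P_2\le\cdots$ are subgroups of $S$ with union $P_\infty$ and $\varphi\in\mathrm{Hom}(P_\infty,S)$ satisfies $\varphi|_{P_n}\in\mathrm{Hom}_{\mathcal F}(P_n,S)$ for all $n$, then $\varphi\in\mathrm{Hom}_{\mathcal F}(P_\infty,S)$. A fusion subsystem of $\mathcal F$ is a subcategory $\mathcal E$ whose objects are the subgroups of some $T\le S$ and which is a fusion system over $T$. For fusion systems $\mathcal E$ over $T$ and $\mathcal F$ over $S$, a morphism from $\mathcal E$ to $\mathcal F$ is a homomorphism $f\colon T\to S$ for which there is a (necessarily unique) functor $\hat f\colon\mathcal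 E\to\mathcal F$ with $\hat f(P)=f(P)$ for all $P\le T$ and $\hat f(\varphi)(f(x))=f(\varphi(x))$ for all $\varphi\in\mathrm{Hom}_{\mathcal E}(P,Q)$ and $x\in P$. $\mathrm{Mor}(\mathcal E,\mathcal F)$ is the set of morphisms, $\mathrm{End}(\mathcal F)=\mathrm{Mor}(\mathcal F,\mathcal F)$, and $\mathrm{Aut}(\mathcal F)$ is the group of invertible elements of $\mathrm{End}(\mathcal F)$. $\mathrm{Im}(f)$ is the smallest fusion subsystem of $\mathcal F$ containing $\hat f(\mathcal E)$. For $\alpha\in\mathrm{Aut}(\mathcal F)$, $\alpha(\mathcal E)$ means $\hat\alpha(\mathcal E)$. The direct product of fusion systems $\mathcal F_i$ over $S_i$ ($1\le i\le k$) is the fusion system over $S_1\times\cdots\times S_k$ with $\mathrm{Hom}(P,Q)=\{(\varphi_1,\dots,\varphi_k)|_P \mid \varphi_i\in\mathrm{Hom}_{\mathcal F_i}(\mathrm{pr}_i(P),\mathrm{pr}_i(Q)),\ (\varphi_1,\dots,\varphi_k)(P)\le Q\}$, $\mathrm{pr}_i$ being the projections. Fusion subsystems $\mathcal E_1,\dots,\mathcal E_k\le\mathcal F$ commute if there is a (necessarily unique) morphism $I\in\mathrm{Mor}(\mathcal E_1\times\cdots\times\mathcal E_k,\mathcal F)$ whose restriction to each factor is the inclusion. One writes $\mathcal F=\mathcal E_1\times\cdots\times\mathcal E_k$ if $\mathcal E_1,\dots,\mathcal E_k\le\mathcal F$ commute and $I$ is an isomorphism of fusion systems. Endomorphisms $f,\chi\in\mathrm{End}(\mathcal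 F)$ are summable if $\mathrm{Im}(f)$ and $\mathrm{Im}(\chi)$ commute; then $f+\chi$ is the homomorphism $x\mapsto f(x)\chi(x)$. An endomorphism $f\in\mathrm{End}(\mathcal F)$ is normal if there is $\chi\in\mathrm{End}(\mathcal F)$ such that $f$ and $\chi$ are summable and $f+\chi=\mathrm{Id}_{\mathcal F}$. For $\Omega\le\mathrm{Aut}(\mathcal F)$: a fusion subsystem $\mathcal E\le\mathcal F$ is $\Omega$-invariant if $\hat\omega(\mathcal E)=\mathcal E$ for each $\omega\in\Omega$; an $\Omega$-invariant subsystem $\mathcal E$ is $\Omega$-indecomposable if there are no proper $\Omega$-invariant subsystems $\mathcal D_1,\mathcal D_2<\mathcal E$ with $\mathcal E=\mathcal D_1\times\mathcal D_2$. $\mathrm{Aut}^\Omega(\mathcal F)$ is the group of normal automorphisms of $\mathcal F$ that commute with every $\omega\in\Omega$.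
   Formalization: Ω-indecomposable subsystems are required here to be nontrivial (not over the trivial group); otherwise the trivial system counts as indecomposable and F = F × 1 would contradict k = m. *)

(* Defs.v *)
From mathcomp Require Import all_boot fingroup perm all_classical.

Set Implicit Arguments.
Unset Strict Implicit.
Unset Printing Implicit Defensive.

Local Open Scope classical_set_scope.
Local Open Scope card_scope.
Local Open Scope group_scope.

(** Subgroups of a (possibly infinite) group [G] are terms of [set G].  A map
    between subgroups [P -> Q] is represented by a total function on [G], and
    two functions represent the same map when they agree on [P].  All sets of
    maps [P -> Q] below are closed under agreement on [P], so that equality of
    such sets is equality of the corresponding sets of maps. *)

Section Groups.
Variables G H : groupType.

Definition subgroup (P : set G) : Prop := group_closed [in P].

Definition group_hom (P : set G) (Q : set H) : set (G -> H) :=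
  [set f | set_fun P Q f /\ {in P &, {morph f : x y / x * y}}].

Definition inverse_on (P : set G) (Q : set H) (f : G -> H) (g : H -> G) : Prop :=
  {in P, cancel f g} /\ {in Q, cancel g f}.

End Groups.

Section Conjugation.
Variable G : groupType.

Definition inj_hom (P Q : set G) : set (G -> G) :=
  [set phi | group_hom P Q phi /\ set_inj P phi].

Definition aut_group (P : set G) : set (G -> G) :=
  [set phi | group_hom P P phi /\ set_bij P P phi].

(* [x ^ g] in the library is g^-1 x g; this is g x g^-1. *)
Definition cg (g x : G) : G := g * x * g^-1.

Definition normalizer (T Q : set G) : set G :=
  [set g | T g /\ cg g @` Q = Q].

Definition conj_hom (T P Q : set G) : set (G -> G) :=
  [set phi | set_fun P Q phi /\ exists2 g, T g & {in P, phi =1 cg g}].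

Definition conj_aut (T P : set G) : set (G -> G) :=
  conj_hom T P P `&` aut_group P.

Definition left_cosets (P : set G) : set (set G) :=
  range (fun x => [set x * y | y in P]).

End Conjugation.

Section DiscretePToral.
Variable p : nat.

Definition cyclic_of_order (A : groupType) (n : nat) (C : set A) : Prop :=
  (exists x, C = range (fun i : nat => x ^+ i)) /\ C #= `I_n.

Definition is_Z_p_infty (A : groupType) : Prop :=
  exists C : nat -> set A,
    [/\ forall n, cyclic_of_order (p ^ n.+1)%N (C n),
        forall n, C n `<=` C n.+1
      & \bigcup_n C n = [set: A]].

Definition discrete_p_toral (S : groupType) : Prop :=
  exists S0 : set S,
    [/\ subgroup S0,
        forall g x, S0 x -> S0 (cg g x),
        exists (A : groupType) (r : nat) (f : {ffun 'I_r -> A} -> S),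
          [/\ is_Z_p_infty A, {morph f : x y / x * y}, injective f
            & range f = S0]
      & exists n, left_cosets S0 #= `I_(p ^ n)%N].

End DiscretePToral.

(** [base F] is the group over which [F] is a fusion system. *)
Record system (G : groupType) := System {
  base : set G;
  Hom : set G -> set G -> set (G -> G)
}.

Section FusionSystems.
Variable G : groupType.
Implicit Types (E F D : system G) (P Q R : set G).

Definition object F P : Prop := subgroup P /\ P `<=` base F.

Definition Iso F P Q : set (G -> G) :=
  [set phi | Hom F P Q phi /\
             exists2 psi, Hom F Q P psi & inverse_on P Q phi psi].

(* Identities and inclusions are in [F] by [fusion_conj], taking g = 1. *)
Record fusion_system F : Prop := FusionSystem {
  fusion_base : subgroup (base F);
  fusion_object : forall P Q phi, Hom F P Q phi -> object F P /\ object F Q;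
  fusion_ext : forall P Q phi psi,
    Hom F P Q phi -> {in P, phi =1 psi} -> Hom F P Q psi;
  fusion_comp : forall P Q R phi psi,
    Hom F P Q phi -> Hom F Q R psi -> Hom F P R (psi \o phi);
  fusion_conj : forall P Q, object F P -> object F Q ->
    conj_hom (base F) P Q `<=` Hom F P Q;
  fusion_inj : forall P Q, Hom F P Q `<=` inj_hom P Q;
  fusion_factor : forall P Q phi, Hom F P Q phi ->
    exists2 R, R `<=` Q & Iso F P R phi
}.

Definition fconjugate F P Q : Prop := exists phi, Iso F P Q phi.

Definition aut_cosets F P : set (set (G -> G)) :=
  [set [set psi : G -> G | exists2 a, conj_aut (base F) P a & {in P, psi =1 phi \o a}]
     | phi in Iso F P P].

Definition fully_automized (p : nat) F P : Prop :=
  exists2 n, aut_cosets F P #= `I_n & coprime n p.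

Definition N_phi F Q P (phi : G -> G) : set G :=
  [set g | normalizer (base F) Q g /\
     exists2 psi, inverse_on Q P phi psi
       & conj_aut (base F) P (phi \o cg g \o psi)].

Definition receptive F P : Prop :=
  forall Q phi, Iso F Q P phi ->
    exists2 phibar, Hom F (N_phi F Q P phi) (base F) phibar
      & {in Q, phibar =1 phi}.

Definition saturated (p : nat) F : Prop :=
  (forall P, object F P ->
     exists Q, [/\ fconjugate F P Q, fully_automized p F Q & receptive F Q]) /\
  (forall (P : nat -> set G) (phi : G -> G),
     (forall n, object F (P n)) -> (forall n, P n `<=` P n.+1) ->
     group_hom (\bigcup_n P n) (base F) phi ->
     (forall n, Hom F (P n) (base F) phi) ->
     Hom F (\bigcup_n P n) (base F) phi).

Definition contained E F : Prop :=
  base E `<=` base F /\ forall P Q, Hom E P Q `<=` Hom F P Q.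

Definition subsystem E F : Prop := fusion_system E /\ contained E F.

Definition proper_subsystem E F : Prop := subsystem E F /\ E <> F.

End FusionSystems.

Section Morphisms.
Variables G H : groupType.
Implicit Types (E : system G) (F : system H) (f : G -> H).

(* [fhat P Q phi] is the image of [phi : P -> Q]. *)
Record is_hat E F f (fhat : set G -> set G -> (G -> G) -> (H -> H)) : Prop :=
  IsHat {
  hat_hom : forall P Q phi, Hom E P Q phi ->
    Hom F (f @` P) (f @` Q) (fhat P Q phi);
  hat_ext : forall P Q phi psi, Hom E P Q phi -> {in P, phi =1 psi} ->
    {in f @` P, fhat P Q phi =1 fhat P Q psi};
  hat_id : forall P, object E P -> {in f @` P, fhat P P id =1 id};
  hat_comp : forall P Q R phi psi, Hom E P Q phi -> Hom E Q R psi ->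
    {in f @` P, fhat P R (psi \o phi) =1 fhat Q R psi \o fhat P Q phi};
  hat_eq : forall P Q phi, Hom E P Q phi ->
    {in P, forall x, fhat P Q phi (f x) = f (phi x)}
}.

Definition Mor E F : set (G -> H) :=
  [set f | group_hom (base E) (base F) f /\ exists fhat, is_hat E F f fhat].

(* The objects and morphisms of the form [fhat P] and [fhat phi]; in general
   this is not a subcategory. *)
Definition hat_image f E : system H :=
  System (f @` base E)
    (fun P' Q' => [set psi : H -> H | exists P Q phi,
       [/\ Hom E P Q phi, P' = f @` P, Q' = f @` Q
         & {in P, forall x, psi (f x) = f (phi x)}]]).

Definition subsystems_above E F f : set (system H) :=
  [set D | subsystem D F /\ contained (hat_image f E) D].

Definition Im E F f : system H :=
  System (\bigcap_(D in subsystems_above E F f) base D)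
    (fun P Q => \bigcap_(D in subsystems_above E F f) Hom D P Q).

End Morphisms.

Definition isomorphism (G H : groupType) (E : system G) (F : system H)
    (f : G -> H) : Prop :=
  Mor E F f /\ exists2 g, Mor F E g & inverse_on (base E) (base F) f g.

Section Products.
Variables (G : groupType) (k : nat).
Implicit Types (F : system G) (E : 'I_k -> system G).

Definition prod_map (phi : 'I_k -> G -> G) (x : {ffun 'I_k -> G}) :
  {ffun 'I_k -> G} := [ffun i => phi i (x i)].

Definition pr (i : 'I_k) (P : set {ffun 'I_k -> G}) : set G :=
  [set x i | x in P].

Definition factor_inj (i : 'I_k) (x : G) : {ffun 'I_k -> G} :=
  [ffun j => if j == i then x else 1].

Definition product_base E : set {ffun 'I_k -> G} :=
  [set x | forall i, base (E i) (x i)].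

Definition direct_product E : system {ffun 'I_k -> G} :=
  System (product_base E) (fun P Q =>
    [set psi : {ffun 'I_k -> G} -> {ffun 'I_k -> G} |
    [/\ subgroup P, P `<=` product_base E,
        subgroup Q & Q `<=` product_base E] /\
    exists phi : 'I_k -> G -> G,
      [/\ forall i, Hom (E i) (pr i P) (pr i Q) (phi i),
          set_fun P Q (prod_map phi)
        & {in P, psi =1 prod_map phi}]]).

Definition commute_via F E (I : {ffun 'I_k -> G} -> G) : Prop :=
  [/\ forall i, subsystem (E i) F,
      Mor (direct_product E) F I
    & forall i, {in base (E i), forall x, I (factor_inj i x) = x}].

Definition fusion_commute F E : Prop := exists I, commute_via F E I.

Definition is_direct_product F E : Prop :=
  exists2 I, commute_via F E I & isomorphism (direct_product E) F I.

End Products.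

Section Endomorphisms.
Variable G : groupType.
Implicit Types (E F : system G) (f chi : G -> G) (Omega : set (G -> G)).

Definition End F : set (G -> G) := Mor F F.

Definition Aut F : set (G -> G) :=
  [set f | End F f /\ exists2 g, End F g & inverse_on (base F) (base F) f g].

Definition Aut_subgroup F Omega : Prop :=
  [/\ Omega `<=` Aut F, Omega id,
      forall f g, Omega f -> Omega g -> Omega (f \o g)
    & forall f, Omega f ->
        exists2 g, Omega g & inverse_on (base F) (base F) f g].

Definition summable F f chi : Prop :=
  [/\ End F f, End F chi
    & fusion_commute F (tnth [tuple Im F F f; Im F F chi])].

Definition normal_end F f : Prop :=
  End F f /\
  exists chi, [/\ End F chi, summable F f chi
                & {in base F, forall x, f x * chi x = x}].

Definition Omega_invariant Omega E : Prop :=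
  forall omega, Omega omega -> hat_image omega E = E.

(* The trivial system has no proper subsystems but is not regarded as
   indecomposable: adding trivial factors to a decomposition would change the
   number of factors. *)
Definition Omega_indecomposable Omega E : Prop :=
  [/\ Omega_invariant Omega E,
      base E <> [set 1]
    & ~ exists D1 D2,
        [/\ proper_subsystem D1 E, Omega_invariant Omega D1,
            proper_subsystem D2 E, Omega_invariant Omega D2
          & is_direct_product E (tnth [tuple D1; D2])]].

Definition Aut_Omega Omega F : set (G -> G) :=
  [set alpha | [/\ Aut F alpha, normal_end F alpha
    & forall omega, Omega omega ->
        {in base F, omega \o alpha =1 alpha \o omega}]].

End Endomorphisms.

(* Main.v *)
Require Import Defs.
From mathcomp Require Import all_boot fingroup perm all_classical.

Local Open Scope classical_set_scope.
Local Open Scope group_scope.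

Set Implicit Arguments.
Unset Strict Implicit.
Unset Printing Implicit Defensive.

(** The proof is the exchange proof of the Krull-Remak-Schmidt theorem,
    carried out in the set [N] of normal endomorphisms of [F] that commute
    with [Omega].

    In a direct decomposition each factor is the full subsystem on its base
    group, so the decomposition is recorded by the projections [e i] of [S]
    onto the base groups: orthogonal idempotents of [N]
    ([product_idempotents]). Conversely an idempotent of [N] below [e i]
    splits the factor as a product of invariant subsystems, so indecomposable
    factors have primitive projections ([indecomposable_primitive]).

    Normality of [f] is used in the following unwound form ([normal_pair]):
    [x = f x * g x] for a homomorphism [g] whose image commutes with that of
    [f], and for two morphisms [phi], [psi] of [F] the map sending [f x * g y]
    to [f (phi x) * g (psi y)] is again a morphism of [F]. In this form it is
    clear that [N] is closed under [f |-> 1 - f] and composition, which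
    produce all the endomorphisms needed.

    The remaining ingredient is that the endomorphisms below a primitive
    idempotent form a local ring. Fitting's lemma would give it for groups
    with chain conditions on both sides, but on [Z/p^oo] the endomorphism
    [x |-> x ^+ p] is onto with a nontrivial kernel. Instead, every point is
    eventually periodic under a normal endomorphism [f]: the iterates of [f]
    at [x] differ from [f x] by central elements of bounded order, and a
    discrete p-toral group has finitely many of these
    ([finite_center_torsion]). The periodic points and the points that [f]
    eventually kills split [S], and the inverse of [f] on the periodic points
    is a locally eventual limit of powers of [f]; it is normal by the
    continuity condition of saturation ([normal_drazin]). So below a primitive
    idempotent an endomorphism is invertible or locally nilpotent
    ([primitive_dichotomy]), and of two endomorphisms with invertible sum one
    is invertible ([corner_inv_add]).

    Given primitive decompositions [d] and [e], some [d e_j d] is therefore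
    invertible below the given [d], and [1 - (1 - e_j) d] is an automorphism
    in [N] that moves the image of [d] onto that of [e_j] and fixes the kernel
    of [d] pointwise ([exchange]). Composing such automorphisms gives the
    required one ([krull_remak_schmidt]). It carries full subsystems to full
    subsystems ([hat_image_full]), and it is normal in the sense of
    summability because its complement has a central image on which [F] acts
    by inclusions ([normal_summable]). *)

(** * Subgroups and homomorphisms *)

Section Subgroups.
Variable G : groupType.
Implicit Types P Q : set G.

Lemma subgroupP P :
  subgroup P <-> P 1 /\ forall x y, P x -> P y -> P (x * y^-1).
Proof.
split=> [[P1 PV]|[P1 PV]].
  split=> [|x y Px Py]; first exact: set_mem.
  by apply: set_mem; apply: PV; apply: mem_set.
by split=> [|x y /set_mem Px /set_mem Py]; apply: mem_set; auto.
Qed.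

Lemma subgroup1 P : subgroup P -> P 1.
Proof. by case/subgroupP. Qed.

Lemma subgroupV P x : subgroup P -> P x -> P x^-1.
Proof. by case/subgroupP=> P1 PV Px; rewrite -[x^-1]mul1g; apply: PV. Qed.

Lemma subgroupM P x y : subgroup P -> P x -> P y -> P (x * y).
Proof.
move=> sP Px Py; rewrite -[y]invgK; case/subgroupP: (sP) => _; apply=> //.
exact: subgroupV.
Qed.

Lemma subgroup_setT : subgroup [set: G].
Proof. by apply/subgroupP; split. Qed.

Lemma subgroupI P Q : subgroup P -> subgroup Q -> subgroup (P `&` Q).
Proof.
move=> /subgroupP[P1 PV] /subgroupP[Q1 QV]; apply/subgroupP; split=> //.
by move=> x y [Px Qx] [Py Qy]; split; [apply: PV | apply: QV].
Qed.

End Subgroups.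

Lemma chain_le T (P : nat -> set T) n m : (forall i, P i `<=` P i.+1) ->
  (n <= m)%N -> P n `<=` P m.
Proof.
move=> Pinc /subnK <-; elim: (m - n)%N => [//|d IHd].
exact: subset_trans IHd (Pinc _).
Qed.

Section Morphs.
Variables G H : groupType.
Implicit Types (P : set G) (f : G -> H).

Lemma morph_on1 P f : subgroup P -> {in P &, {morph f : x y / x * y}} ->
  f 1 = 1.
Proof.
move=> sP fM; have P1 := mem_set (subgroup1 sP).
by apply: (@mulgI _ (f 1)); rewrite -fM // !mulg1.
Qed.

Lemma morph_onV P f x : subgroup P -> {in P &, {morph f : x y / x * y}} ->
  P x -> f x^-1 = (f x)^-1.
Proof.
move=> sP fM Px; apply: (@mulgI _ (f x)).
rewrite mulgV -fM; [|exact: mem_set|by apply: mem_set; apply: subgroupV].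
by rewrite mulgV; apply: morph_on1 fM.
Qed.

Lemma morph_morph_on P f : {morph f : x y / x * y} ->
  {in P &, {morph f : x y / x * y}}.
Proof. by move=> fM x y _ _; apply: fM. Qed.

Lemma morph1 f : {morph f : x y / x * y} -> f 1 = 1.
Proof. by move=> fM; apply: (morph_on1 (subgroup_setT G)) => x y _ _. Qed.

Lemma morphV f : {morph f : x y / x * y} -> {morph f : x / x^-1}.
Proof.
by move=> fM x; apply: (morph_onV (subgroup_setT G)) => // u v _ _.
Qed.

Lemma subgroup_image P f : subgroup P -> {in P &, {morph f : x y / x * y}} ->
  subgroup (f @` P).
Proof.
move=> sP fM; apply/subgroupP; split.
  by exists 1; [apply: subgroup1 | apply: morph_on1 fM].
move=> _ _ [x Px <-] [y Py <-]; exists (x * y^-1).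
  by apply: subgroupM => //; apply: subgroupV.
rewrite fM; [|exact: mem_set|by apply: mem_set; apply: subgroupV].
by rewrite (morph_onV sP fM).
Qed.

Lemma subgroup_range f : {morph f : x y / x * y} -> subgroup (range f).
Proof.
move=> fM; apply: subgroup_image (subgroup_setT G) _.
exact: morph_morph_on.
Qed.

End Morphs.

(** * Morphisms of a fusion system *)

Section FusionSystem.
Variables (S : groupType) (E : system S).
Hypothesis E_fusion : fusion_system E.
Implicit Types (P Q R : set S) (phi psi : S -> S).

Lemma Hom_incl P Q : object E P -> object E Q -> P `<=` Q -> Hom E P Q id.
Proof.
move=> oP oQ PQ; apply: (fusion_conj E_fusion) => //; split=> //.
exists 1; first exact: subgroup1 (fusion_base E_fusion).
by move=> x _; rewrite /cg invg1 mulg1 mul1g.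
Qed.

Lemma Hom_fun P Q phi x : Hom E P Q phi -> P x -> Q (phi x).
Proof. by case/(fusion_inj E_fusion)=> -[+ _] _; apply. Qed.

Lemma Iso_image P Q phi : Iso E P Q phi -> phi @` P = Q.
Proof.
case=> Ephi [psi Epsi [_ psiK]]; apply/seteqP; split=> [_ [x Px <-]|y Qy].
  exact: Hom_fun Ephi Px.
by exists (psi y); [apply: Hom_fun Epsi Qy | apply/psiK/mem_set].
Qed.

(** Every morphism factors through its image, so that its target may be
    replaced by any object containing its values. *)
Lemma Hom_target P Q R phi : Hom E P Q phi -> object E R ->
  (forall x, P x -> R (phi x)) -> Hom E P R phi.
Proof.
move=> Ephi oR PR; have [Q' _ isoQ'] := fusion_factor E_fusion Ephi.
have eQ' := Iso_image isoQ'; case: isoQ' => Ephi' _.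
have [_ oQ'] := fusion_object E_fusion Ephi'.
apply: (fusion_comp E_fusion Ephi' (Hom_incl oQ' oR _)).
by rewrite -eQ' => _ [x Px <-]; apply: PR.
Qed.

End FusionSystem.

Section FullSubsystems.
Variables (S : groupType) (F : system S).
Hypothesis F_fusion : fusion_system F.
Hypothesis F_base : base F = [set: S].
Implicit Types (P Q R T : set S) (phi psi : S -> S).

(** By [HomE] below the target of a morphism can be forgotten. *)
Definition fmor P phi : Prop := Hom F P [set: S] phi.

Definition full T : system S :=
  System T (fun P Q => [set phi | [/\ P `<=` T, Q `<=` T & Hom F P Q phi]]).

Lemma objectE P : object F P <-> subgroup P.
Proof. by split=> [[]//|sP]; split=> //; rewrite F_base. Qed.

Lemma Hom_subgroup P Q phi : Hom F P Q phi -> subgroup P /\ subgroup Q.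
Proof. by case/(fusion_object F_fusion)=> -[? _] [? _]. Qed.

Lemma Hom_morph P Q phi : Hom F P Q phi ->
  {in P &, {morph phi : x y / x * y}}.
Proof. by case/(fusion_inj F_fusion)=> -[]. Qed.

Lemma HomE P Q phi :
  Hom F P Q phi <-> [/\ fmor P phi, subgroup Q & forall x, P x -> Q (phi x)].
Proof.
split=> [Fphi|[Fphi sQ PQ]]; last first.
  by apply: Hom_target Fphi _ PQ => //; apply/objectE.
have [_ sQ] := Hom_subgroup Fphi; split=> //.
  by apply: Hom_target Fphi _ _ => //; apply/objectE/subgroup_setT.
by move=> x; apply: Hom_fun Fphi.
Qed.

Lemma fmor_Hom P Q phi : Hom F P Q phi -> fmor P phi.
Proof. by case/HomE. Qed.

Lemma fmor_subgroup P phi : fmor P phi -> subgroup P.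
Proof. by case/Hom_subgroup. Qed.

Lemma fmorM P phi x y : fmor P phi -> P x -> P y ->
  phi (x * y) = phi x * phi y.
Proof. by move=> Fphi Px Py; apply: (Hom_morph Fphi); apply: mem_set. Qed.

Lemma fmor1 P phi : fmor P phi -> phi 1 = 1.
Proof.
by move=> Fphi; apply: (morph_on1 (fmor_subgroup Fphi)) (Hom_morph Fphi).
Qed.

Lemma fmor_ext P phi psi : fmor P phi -> (forall x, P x -> phi x = psi x) ->
  fmor P psi.
Proof.
by move=> Fphi e; apply: (fusion_ext F_fusion Fphi) => x /set_mem /e.
Qed.

Lemma fmor_id P : subgroup P -> fmor P id.
Proof.
by move=> sP; apply: Hom_incl => //; apply/objectE => //; apply: subgroup_setT.
Qed.

Lemma fmor_sub P Q phi : fmor P phi -> subgroup Q -> Q `<=` P -> fmor Q phi.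
Proof.
move=> Fphi sQ QP.
have FQP : Hom F Q P id.
  by apply: Hom_incl => //; apply/objectE => //; apply: fmor_subgroup Fphi.
exact: (fusion_comp F_fusion FQP Fphi).
Qed.

Lemma subsystem_full T : subgroup T -> subsystem (full T) F.
Proof.
move=> sT; split; last by split=> [|P Q phi []//]; rewrite F_base.
have obj P Q phi : Hom (full T) P Q phi ->
    object (full T) P /\ object (full T) Q.
  by case=> PT QT /Hom_subgroup[].
split=> //=.
- move=> P Q phi psi [PT QT Fphi] e; split=> //.
  exact: fusion_ext e.
- move=> P Q R phi psi [PT QT Fphi] [_ RT Fpsi]; split=> //.
  exact: fusion_comp Fpsi.
- move=> P Q [sP PT] [sQ QT] phi [PQ [g Tg e]]; split=> //.
  apply: (fusion_conj F_fusion); try exact/objectE.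
  by split=> //; exists g => //; rewrite F_base.
- by move=> P Q phi [_ _ /(fusion_inj F_fusion)].
- move=> P Q phi [PT QT Fphi]; have [R RQ isoR] := fusion_factor F_fusion Fphi.
  exists R => //; case: isoR => Fphi' [psi Fpsi psiK].
  have RT := subset_trans RQ QT.
  by split; [|exists psi].
Qed.

End FullSubsystems.

(** * Finiteness in discrete p-toral groups *)

Lemma finite_collision T (A : set T) (f : nat -> T) :
  finite_set A -> (forall i, A (f i)) -> exists i j, (i < j)%N /\ f i = f j.
Proof.
move=> finA Af; apply: contrapT => nex.
have finj : {in setT &, injective f}.
  move=> i j _ _ e; case: (ltngtP i j) => // ij; case: nex.
    by exists i, j.
  by exists j, i.
apply: infinite_nat; rewrite -(eq_finite_set (inj_card_eq finj)).
by apply: sub_finite_set finA => _ [n _ <-].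
Qed.

Lemma expg_order (G : groupType) (x : G) n : (0 < n)%N -> x ^+ n = 1 ->
  exists o, [/\ (0 < o)%N, x ^+ o = 1 & forall i, x ^+ i = 1 -> (o %| i)%N].
Proof.
move=> n0 xn; have ex : exists o, (0 < o)%N && (x ^+ o == 1).
  by exists n; rewrite n0 xn eqxx.
case: (ex_minnP ex) => o /andP[o0 /eqP xo] omin; exists o; split=> // i.
rewrite (divn_eq i o) expgnDr mulnC expgnA xo expg1n mul1g => xr.
rewrite dvdn_addr ?dvdn_mulr //; case: (posnP (i %% o)) => [->|r0] //.
have := omin (i %% o)%N; rewrite r0 xr eqxx => /(_ isT).
by rewrite leqNgt ltn_mod o0.
Qed.

Lemma finite_expg (G : groupType) (x : G) (A : set G) : finite_set A ->
  (forall i, A (x ^+ i)) -> exists2 n, (0 < n)%N & x ^+ n = 1.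
Proof.
move=> finA Ax; have [i [j [ij e]]] :=
  @finite_collision _ A (fun i => x ^+ i) finA Ax.
by exists (j - i)%N; rewrite ?subn_gt0 // expgnFr ?(ltnW ij) // e mulgV.
Qed.

Section PToral.
Variable p : nat.

Lemma Z_p_infty_torsion (A : groupType) (x : A) : is_Z_p_infty p A ->
  exists2 n, (0 < n)%N & x ^+ n = 1.
Proof.
case=> C [Ccyc _ Call]; have [n _ Cx] : (\bigcup_n C n) x by rewrite Call.
have [[c eC] cardC] := Ccyc n.
have finC : finite_set (C n) by apply/finite_setP; exists (p ^ n.+1)%N.
apply: (finite_expg finC) => i; move: Cx; rewrite eC => -[j _ <-].
by exists (j * i)%N => //; rewrite expgnA.
Qed.

(** A finite cyclic group has at most [m] elements of order dividing [m], so
    that this bound passes to the union of a chain of such groups. *)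
Lemma finite_Z_p_infty_torsion (A : groupType) m : is_Z_p_infty p A ->
  (0 < m)%N -> finite_set [set x : A | x ^+ m = 1].
Proof.
move=> hA m0; have [C [Ccyc Cinc Call]] := hA.
have Cle i j : (i <= j)%N -> C i `<=` C j by apply: chain_le.
have Cm n : exists g : nat -> A, C n `&` [set x | x ^+ m = 1] `<=` g @` `I_m.
  have [[c eC] _] := Ccyc n; have [o' o'0 co'] := Z_p_infty_torsion c hA.
  have [o [o0 co odiv]] := expg_order o'0 co'.
  exists (fun j => c ^+ ((o * j) %/ m)); rewrite eC => _ [[i _ <-] /= cim].
  have ci : c ^+ (i %% o) = c ^+ i.
    by rewrite {2}(divn_eq i o) expgnDr mulnC expgnA co expg1n mul1g.
  have /dvdnP[j ej] : (o %| (i %% o) * m)%N.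
    by apply: odiv; rewrite expgnA ci.
  exists j; last by rewrite mulnC -ej mulnK.
  by rewrite /= -(ltn_pmul2r o0) -ej mulnC ltn_pmul2l ?ltn_mod.
apply: contrapT => /(infinite_set_fset m.+1)[X Xm cardX].
have [n Xn] : exists n, forall x, x \in (finmap.enum_fset X) -> C n x.
  elim: (finmap.enum_fset X) => [|x s [n IHs]]; first by exists 0%N.
  have [l _ Cl] : (\bigcup_n C n) x by rewrite Call.
  exists (maxn n l) => y; rewrite inE => /predU1P[->|/IHs].
    exact: Cle (leq_maxr _ _) _ Cl.
  exact: Cle (leq_maxl _ _) _.
have [g Cg] := Cm n.
have : (size (finmap.enum_fset X) <= size [seq g i | i <- iota 0 m])%N.
  apply: uniq_leq_size (finmap.fset_uniq X) _ => x Xx.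
  have [|i im <-] := Cg x; first by split; [apply: Xn|apply: Xm].
  by rewrite map_f // mem_iota.
by rewrite size_map size_iota leqNgt cardX.
Qed.

Lemma finite_ffun r (A : choiceType) (B : set A) : finite_set B ->
  finite_set [set y : {ffun 'I_r -> A} | forall i, B (y i)].
Proof.
move=> /finite_seqP[s ->].
pose h (g : {ffun 'I_r -> seq_sub s}) := [ffun i => val (g i)].
apply: (@sub_finite_set _ _ (h @` setT)).
  move=> y sy; exists [ffun i => SeqSub (sy i)] => //.
  by apply/ffunP => i; rewrite !ffunE.
exact/finite_image/finite_finset.
Qed.

Variable S : groupType.
Hypothesis S_toral : discrete_p_toral p S.

Lemma toral_torsion (x : S) : exists2 n, (0 < n)%N & x ^+ n = 1.
Proof.
have [S0 [sS0 _ [A [r [f [hA fM finj fE]]]] [n cardS]]] := S_toral.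
have finS : finite_set (left_cosets S0).
  by apply/finite_setP; exists (p ^ n)%N.
have [i [j [ij e]]] := finite_collision finS
  (fun i => ex_intro2 _ _ (x ^+ i) I erefl).
have : S0 (x ^+ (j - i)).
  have : [set x ^+ j * y | y in S0] (x ^+ j).
    by exists 1; [apply: subgroup1|rewrite mulg1].
  rewrite -e => -[s Ss es]; suff -> : x ^+ (j - i) = s by [].
  by apply: (@mulgI _ (x ^+ i)); rewrite es -expgnDr subnKC ?(ltnW ij).
rewrite -fE => -[y _ ey].
have /choice[o oP] k : exists o, (0 < o)%N /\ y k ^+ o = 1.
  by have [o o0 yo] := Z_p_infty_torsion (y k) hA; exists o.
pose q := (\prod_(k < r) o k)%N.
have q0 : (0 < q)%N by apply: prodn_gt0 => k; case: (oP k).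
have yX l : y ^+ l = [ffun k => y k ^+ l].
  elim: l => [|l IHl]; first by apply/ffunP => k; rewrite !ffunE.
  by rewrite expgS IHl; apply/ffunP => k; rewrite !ffunE expgS.
have yq : y ^+ q = 1.
  rewrite yX; apply/ffunP => k; rewrite !ffunE /q (bigD1 k) //= expgnA.
  by rewrite (oP k).2 expg1n.
exists ((j - i) * q)%N; first by rewrite muln_gt0 subn_gt0 ij.
rewrite expgnA -ey -(morph1 fM) -yq; elim: (q) => [|l IHl].
  by rewrite !expg0 (morph1 fM).
by rewrite !expgS fM IHl.
Qed.

(** Central elements of order dividing [m] in the same coset of the torus
    differ by an element of the torus of order dividing [m]. *)
Lemma finite_center_torsion m : (0 < m)%N ->
  finite_set [set z : S | z ^+ m = 1 /\ forall y, commute z y].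
Proof.
move=> m0; have [S0 [sS0 _ [A [r [f [hA fM finj fE]]]] [n cardS]]] := S_toral.
set Z := [set z | _].
have finS : finite_set (left_cosets S0).
  by apply/finite_setP; exists (p ^ n)%N.
have fX y l : f (y ^+ l) = f y ^+ l.
  by elim: l => [|l IHl]; rewrite ?expg0 ?(morph1 fM) // !expgS fM IHl.
have yX (y : {ffun 'I_r -> A}) l k : (y ^+ l) k = y k ^+ l.
  by elim: l => [|l IHl]; rewrite ?ffunE // !expgS ffunE IHl.
have finS0 : finite_set (S0 `&` [set s | s ^+ m = 1]).
  apply: (@sub_finite_set _ _
    (f @` [set y : {ffun 'I_r -> A} | forall i, y i ^+ m = 1])).
    rewrite -fE => _ [[y _ <-] /= ym]; exists y => // i.
    by rewrite -yX (finj (y ^+ m) 1) ?ffunE // fX ym (morph1 fM).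
  apply: finite_image; apply: (@finite_ffun r A [set x | x ^+ m = 1]).
  exact: finite_Z_p_infty_torsion.
pose coset (z : S) := [set z * y | y in S0].
have -> : Z = \bigcup_(c in left_cosets S0) (Z `&` [set z | coset z = c]).
  apply/seteqP; split=> [z Zz|z [c _ []]//].
  by exists (coset z) => //; exists z.
apply: bigcup_finite => // c _.
have [[z0 [[z0m z0c] ez0]]|nex] :=
    pselect (exists z, (Z `&` [set z | coset z = c]) z); last first.
  by apply: sub_finite_set (finite_set0 S) => z Zz; case: nex; exists z.
apply: (sub_finite_set _ (finite_image (fun s => z0 * s) finS0)).
move=> z [[zm zc] ez].
have : coset z z by exists 1; [apply: subgroup1|rewrite mulg1].
rewrite [coset z]ez -ez0 => -[s Ss es]; exists s => //; split=> //=.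
have := zm; rewrite -es expgMn; last exact: z0c.
by rewrite z0m mul1g.
Qed.

End PToral.

(** * Normal endomorphisms *)

Section Complement.
Variable S : groupType.
Implicit Types f g : S -> S.

(** The endomorphism [1 - f] in additive notation *)
Definition compl f x : S := (f x)^-1 * x.

Lemma mul_compl f x : f x * compl f x = x.
Proof. by rewrite /compl mulVKg. Qed.

Lemma compl_uniq f g : (forall x, f x * g x = x) -> g = compl f.
Proof.
by move=> fg; apply: funext => x; rewrite /compl -{3}(fg x) mulKg.
Qed.

End Complement.

Section NormalPairs.
Variables (S : groupType) (F : system S) (Omega : set (S -> S)).
Hypothesis F_fusion : fusion_system F.
Hypothesis F_base : base F = [set: S].
Hypothesis Omega_morph : forall w, Omega w -> {morph w : x y / x * y}.
Implicit Types (P Q R T : set S) (f g phi psi w : S -> S).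

Definition mulset P Q : set S := [set x * y | x in P & y in Q].

(** [np_fmor] says that the images of [f] and [g] commute as fusion subsystems,
    in terms of morphisms of [F] only: two morphisms of [F] are transported by
    [f] and by [g] and then combined on the product of the images. Since
    the images commute elementwise, the conditions are symmetric in [f] and
    [g]. *)
Record normal_pair f g : Prop := NormalPair {
  np_morphl : {morph f : x y / x * y};
  np_morphr : {morph g : x y / x * y};
  np_split : forall x, f x * g x = x;
  np_comm : forall x y, commute (f x) (g y);
  np_fmor : forall P Q phi psi, fmor F P phi -> fmor F Q psi ->
    exists2 theta, fmor F (mulset (f @` P) (g @` Q)) theta
      & forall x y, P x -> Q y -> theta (f x * g y) = f (phi x) * g (psi y);
  np_equivl : forall w x, Omega w -> f (w x) = w (f x);
  np_equivr : forall w x, Omega w -> g (w x) = w (g x)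
}.

Definition normal_endo f : Prop := normal_pair f (compl f).

Lemma normalP f : normal_endo f <-> exists g, normal_pair f g.
Proof.
split=> [nf|[g nfg]]; first by exists (compl f).
by rewrite /normal_endo -(compl_uniq (np_split nfg)).
Qed.

Lemma normal_pairC f g : normal_pair f g -> normal_pair g f.
Proof.
case=> fM gM fgE fgC fgF fw gw; split=> //.
- by move=> x; rewrite -[RHS]fgE; apply/esym/fgC.
- by move=> x y; apply/commute_sym/fgC.
move=> P Q phi psi Fphi Fpsi; have [theta Ft tE] := fgF _ _ _ _ Fpsi Fphi.
exists theta => [|x y Px Qy]; last by rewrite -fgC tE // fgC.
have <-// : mulset (f @` Q) (g @` P) = mulset (g @` P) (f @` Q).
apply/seteqP; split=> _ [_ [x Px <-] [_ [y Qy <-] <-]].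
  by rewrite fgC; exists (g y); [exists y | exists (f x); [exists x|]].
by rewrite -fgC; exists (f y); [exists y | exists (g x); [exists x|]].
Qed.

Lemma normal_compl f : normal_endo f -> normal_endo (compl f).
Proof. by move=> nf; apply/normalP; exists f; apply: normal_pairC. Qed.

Lemma subgroup_mulset P Q : subgroup P -> subgroup Q ->
  (forall x y, P x -> Q y -> commute x y) -> subgroup (mulset P Q).
Proof.
move=> sP sQ cPQ; apply/subgroupP; split.
  exists 1; first exact: subgroup1.
  by exists 1; [exact: subgroup1|rewrite mulg1].
move=> _ _ [x Px [y Qy <-]] [x' Px' [y' Qy' <-]].
have Pv := subgroupV sP Px'; have Qv := subgroupV sQ Qy'.
exists (x * x'^-1); first exact: subgroupM.
exists (y * y'^-1); first exact: subgroupM.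
have cv : commute x'^-1 (y * y'^-1) by apply: cPQ => //; apply: subgroupM.
by rewrite invgM -mulgA cv !mulgA.
Qed.

(** The complement comes from [1 - f g = f (1 - g) + (1 - f)]. For [np_fmor],
    combine the two morphisms along [g] first, and then combine the result with
    the second one along [f]. *)
Lemma normal_pair_comp f f' g g' : normal_pair f f' -> normal_pair g g' ->
  normal_pair (f \o g) (fun y => f (g' y) * f' y).
Proof.
move=> [fM f'M fE fC fF fw f'w] [gM g'M gE gC gF gw g'w].
have cfg x y : commute (f (g x)) (f (g' y) * f' y).
  apply: commuteM; last exact: fC.
  by rewrite /commute -!fM gC.
have hM : {morph (fun y => f (g' y) * f' y) : x y / x * y}.
  move=> x y; rewrite g'M f'M fM -!mulgA; congr (_ * _).
  by rewrite !mulgA fC.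
have fgM : {morph f \o g : x y / x * y} by move=> x y /=; rewrite gM fM.
split=> //=.
- by move=> x; rewrite mulgA -fM gE fE.
- move=> P Q phi psi Fphi Fpsi.
  have [t1 Ft1 t1E] := gF _ _ _ _ Fphi Fpsi.
  have [t Ft tE] := fF _ _ _ _ Ft1 Fpsi.
  have gP x y : P x -> Q y -> mulset (g @` P) (g' @` Q) (g x * g' y).
    by move=> Px Qy; exists (g x); [exists x | exists (g' y); [exists y|]].
  have tE' x y : P x -> Q y ->
      t (f (g x) * (f (g' y) * f' y)) =
      f (g (phi x)) * (f (g' (psi y)) * f' (psi y)).
    by move=> Px Qy; rewrite !mulgA -!fM tE ?t1E //; apply: gP.
  exists t => //; apply: (fmor_sub F_fusion F_base Ft).
    apply: subgroup_mulset.
    + apply: subgroup_image; first exact: fmor_subgroup Fphi.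
      exact: morph_morph_on.
    + apply: subgroup_image; first exact: fmor_subgroup Fpsi.
      exact: morph_morph_on.
    + by move=> _ _ [x _ <-] [y _ <-]; apply: cfg.
  move=> _ [_ [x Px <-] [_ [y Qy <-] <-]]; rewrite /= mulgA -fM.
  exists (f (g x * g' y)); first by exists (g x * g' y) => //; apply: gP.
  by exists (f' y) => //; exists y.
- by move=> w x Ow; rewrite gw // fw.
- by move=> w x Ow; rewrite g'w // fw // f'w // Omega_morph.
Qed.

Lemma normal_comp f g : normal_endo f -> normal_endo g -> normal_endo (f \o g).
Proof.
move=> nf ng; apply/normalP; exists (fun y => f (compl g y) * compl f y).
exact: normal_pair_comp.
Qed.

Lemma normal_id : normal_endo id.
Proof.
apply/normalP; exists (fun=> 1); split=> //.
- by move=> x y; rewrite mulg1.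
- by move=> x; rewrite mulg1.
- by move=> x y; apply: commute1.
- move=> P Q phi psi Fphi Fpsi; exists phi; last by move=> *; rewrite !mulg1.
  have <-// : P = mulset (id @` P) ((fun=> 1) @` Q).
  apply/seteqP; split=> [x Px|_ [_ [x Px <-] [_ [y Qy <-] <-]]].
    exists x; first by exists x.
    exists 1; last by rewrite mulg1.
    by exists 1 => //; apply: subgroup1; apply: fmor_subgroup Fpsi.
  by rewrite mulg1.
by move=> w x Ow; rewrite (morph1 (Omega_morph Ow)).
Qed.

Lemma normal_iter f n : normal_endo f -> normal_endo (iter n f).
Proof.
move=> nf; elim: n => [|n IHn]; first exact: normal_id.
exact: normal_comp nf IHn.
Qed.

(** Combining with a morphism of the trivial group in [np_fmor] gives the
    functor attached to [f]. *)
Lemma normal_hat f P phi : normal_endo f -> fmor F P phi ->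
  exists2 psi, fmor F (f @` P) psi & forall x, P x -> psi (f x) = f (phi x).
Proof.
move=> nf Fphi; have s1 : subgroup [set (1 : S)].
  by apply/subgroupP; split=> // x y -> ->; rewrite mulgV.
have f'1 := morph1 (np_morphr nf).
have [t Ft tE] := np_fmor nf Fphi (fmor_id F_fusion F_base s1).
exists t => [|x Px]; last by have := tE x 1 Px erefl; rewrite f'1 !mulg1.
have <-// : mulset (f @` P) (compl f @` [set 1]) = f @` P.
apply/seteqP; split=> [_ [_ [x Px <-] [_ [_ -> <-] <-]]|_ [x Px <-]].
  by rewrite f'1 mulg1; exists x.
exists (f x); first by exists x.
by exists 1; [exists 1|rewrite mulg1].
Qed.

(** The hypothesis says that the complement of [f] kills [f x]. Then it also
    kills [psi (f x) = f (phi x)], where [psi] is induced by [phi], because [psi]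
    in turn induces a morphism on the image of the complement, which fixes [1].
    For a power of [f], this shows that the eventually periodic points of a given
    period are preserved by fusion. *)
Lemma normal_fix_fmor f P phi x : normal_endo f -> fmor F P phi -> P x ->
  f (f x) = f x -> f (f (phi x)) = f (phi x).
Proof.
move=> nf Fphi Px ffx; have [psi Fpsi psiE] := normal_hat nf Fphi.
have [theta Ft tE] := normal_hat (normal_compl nf) Fpsi.
have c1 : compl f (f x) = 1 by rewrite /compl ffx mulVg.
have := tE (f x) (ex_intro2 _ _ x Px erefl).
rewrite c1 (fmor1 F_fusion Ft) (psiE _ Px) /compl => e.
by apply/esym; rewrite -[LHS](mulVKg (f (f (phi x)))) -e mulg1.
Qed.

Hypothesis F_union : forall (P : nat -> set S) (phi : S -> S),
  (forall n, object F (P n)) -> (forall n, P n `<=` P n.+1) ->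
  group_hom (\bigcup_n P n) (base F) phi ->
  (forall n, Hom F (P n) (base F) phi) ->
  Hom F (\bigcup_n P n) (base F) phi.

Lemma fmor_union (P : nat -> set S) phi :
  (forall n, P n `<=` P n.+1) -> (forall n, fmor F (P n) phi) ->
  fmor F (\bigcup_n P n) phi.
Proof.
move=> Pinc FP; rewrite /fmor -F_base; apply: F_union => //.
- by move=> n; apply/(objectE F_base); apply: fmor_subgroup (FP n).
- split=> [x _|]; first by rewrite F_base.
  have Ple n m : (n <= m)%N -> P n `<=` P m by apply: chain_le.
  move=> x y /set_mem[n _ Px] /set_mem[m _ Py].
  apply: (fmorM F_fusion (FP (maxn n m))).
    exact: (Ple _ _ (leq_maxl n m)).
  exact: (Ple _ _ (leq_maxr n m)).
- by move=> n; rewrite F_base; apply: FP.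
Qed.

(** A locally eventual limit of normal endomorphisms is normal. The stages [T]
    must be preserved by fusion, as the square for [phi] compares the values of
    the limit at [x] and at [phi x]. *)
Lemma normal_pair_limit (f_ g_ : nat -> S -> S) (T : nat -> set S) f g :
  (forall n, normal_pair (f_ n) (g_ n)) ->
  (forall n, subgroup (T n)) -> (forall n, T n `<=` T n.+1) ->
  (forall x, exists n, T n x) ->
  (forall n P phi x, fmor F P phi -> P x -> T n x -> T n (phi x)) ->
  (forall n w x, Omega w -> T n x -> T n (w x)) ->
  (forall n x, T n x -> f x = f_ n x /\ g x = g_ n x) ->
  normal_pair f g.
Proof.
move=> nfg sT Tinc Tall Tphi Tw fgE.
have Tle n m : (n <= m)%N -> T n `<=` T m by apply: chain_le.
have Tall2 x y : exists n, T n x /\ T n y.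
  have [[n Tx] [m Ty]] := (Tall x, Tall y); exists (maxn n m).
  by split; [apply: Tle Tx; apply: leq_maxl|apply: Tle Ty; apply: leq_maxr].
have fE n x : T n x -> f x = f_ n x by case/fgE.
have gE n x : T n x -> g x = g_ n x by case/fgE.
split.
- move=> x y; have [n [Tx Ty]] := Tall2 x y; have Txy := subgroupM (sT n) Tx Ty.
  by rewrite !(fE n) // (np_morphl (nfg n)).
- move=> x y; have [n [Tx Ty]] := Tall2 x y; have Txy := subgroupM (sT n) Tx Ty.
  by rewrite !(gE n) // (np_morphr (nfg n)).
- move=> x; have [n Tx] := Tall x.
  by rewrite (fE n) // (gE n) // (np_split (nfg n)).
- move=> x y; have [n [Tx Ty]] := Tall2 x y.
  by rewrite (fE n) // (gE n) //; apply: (np_comm (nfg n)).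
- move=> P Q phi psi Fphi Fpsi.
  pose R n := mulset (f_ n @` (P `&` T n)) (g_ n @` (Q `&` T n)).
  have RE n : R n = mulset (f @` (P `&` T n)) (g @` (Q `&` T n)).
    rewrite /R; congr mulset; apply/seteqP.
      by split=> _ [x [Px Tx] <-]; exists x; rewrite ?(fE n).
    by split=> _ [x [Px Tx] <-]; exists x; rewrite ?(gE n).
  have Rall : mulset (f @` P) (g @` Q) = \bigcup_n R n.
    apply/seteqP; split=> [_ [_ [x Px <-] [_ [y Qy <-] <-]]|r [n _]].
      have [n [Tx Ty]] := Tall2 x y; exists n => //; rewrite RE.
      by exists (f x); [exists x|exists (g y); [exists y|]].
    rewrite RE => -[_ [x [Px Tx] <-] [_ [y [Qy Ty] <-] <-]].
    by exists (f x); [exists x|exists (g y); [exists y|]].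
  have [sP sQ] := (fmor_subgroup F_fusion Fphi, fmor_subgroup F_fusion Fpsi).
  have tP n : exists2 t, fmor F (R n) t & forall x y, P x -> Q y -> T n x ->
      T n y -> t (f x * g y) = f (phi x) * g (psi y).
    have Fphin : fmor F (P `&` T n) phi.
      apply: (fmor_sub F_fusion F_base Fphi); last exact: subIsetl.
      exact: subgroupI.
    have Fpsin : fmor F (Q `&` T n) psi.
      apply: (fmor_sub F_fusion F_base Fpsi); last exact: subIsetl.
      exact: subgroupI.
    have [t Ft tE] := np_fmor (nfg n) Fphin Fpsin; exists t => //.
    move=> x y Px Qy Tx Ty; rewrite !(fE n) ?(gE n) ?tE //.
      exact: Tphi Fpsi _ _.
    exact: Tphi Fphi _ _.
  (* The morphisms of [tP] agree with one map [theta] on all stages. *)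
  pose good r z := exists x y, [/\ P x, Q y, r = f x * g y
                                & z = f (phi x) * g (psi y)].
  pose theta r := xget 1 (good r).
  have thetaE x y : P x -> Q y -> theta (f x * g y) = f (phi x) * g (psi y).
    move=> Px Qy; rewrite /theta; case: xgetP => [z _|]; last first.
      by move/(_ (f (phi x) * g (psi y))); case; exists x, y.
    case=> x' [y' [Px' Qy' e ->]].
    have [[n [Tx Ty]] [m [Tx' Ty']]] := (Tall2 x y, Tall2 x' y').
    have [t _ tE] := tP (maxn n m).
    have [nM mM] := (leq_maxl n m, leq_maxr n m).
    have exy := tE x y Px Qy (Tle _ _ nM _ Tx) (Tle _ _ nM _ Ty).
    have exy' := tE x' y' Px' Qy' (Tle _ _ mM _ Tx') (Tle _ _ mM _ Ty').
    by rewrite -exy -exy' e.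
  exists theta => //; rewrite Rall; apply: fmor_union.
    move=> n r; rewrite !RE => -[_ [x [Px Tx] <-] [_ [y [Qy Ty] <-] <-]].
    exists (f x); first by exists x => //; split=> //; apply: Tinc.
    by exists (g y) => //; exists y => //; split=> //; apply: Tinc.
  move=> n; have [t Ft tE] := tP n; apply: (fmor_ext F_fusion Ft) => r.
  rewrite RE => -[_ [x [Px Tx] <-] [_ [y [Qy Ty] <-] <-]].
  by rewrite thetaE // tE.
- move=> w x Ow; have [n Tx] := Tall x.
  by rewrite (fE _ _ Tx) (fE _ _ (Tw _ _ _ Ow Tx)) (np_equivl (nfg n)).
- move=> w x Ow; have [n Tx] := Tall x.
  by rewrite (gE _ _ Tx) (gE _ _ (Tw _ _ _ Ow Tx)) (np_equivr (nfg n)).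
Qed.

Hypothesis S_torsion : forall x : S, exists2 n, (0 < n)%N & x ^+ n = 1.
Hypothesis S_center : forall n, (0 < n)%N ->
  finite_set [set z : S | z ^+ n = 1 /\ forall y, commute z y].

(** The factors [f (f x)] and [f x] differ by [f (compl f x)], which lies in the
    image of [f] and in that of its complement and is therefore central. So all
    iterates of [f] at [x] differ from [f x] by central elements of bounded
    order. *)
Lemma normal_iter_central f x n : normal_endo f ->
  exists2 z, iter n.+1 f x = f x * z & forall y, commute z y.
Proof.
move=> nf; elim: n => [|n [z e cz]].
  by exists 1; rewrite ?mulg1 // => y; apply/commute_sym/commute1.
pose u := iter n f x.
have cE : f (compl f u) = compl f (f u).
  by rewrite {2}/compl -{3}(mul_compl f u) (np_morphl nf) mulKg.
have cc y : commute (compl f (f u)) y.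
  rewrite -(mul_compl f y); apply: commuteM; first exact/commute_sym/np_comm.
  by rewrite -cE; apply: np_comm.
exists (z * (compl f (f u))^-1).
  rewrite mulgA -e /= -/u.
  by apply: (@mulIg _ (compl f (f u))); rewrite mul_compl mulgVK.
move=> y; apply/commute_sym/commuteM; first exact/commute_sym.
exact/commuteV/commute_sym.
Qed.

Lemma iter_periodic f x i d q : iter (i + d) f x = iter i f x ->
  iter (i + d * q) f x = iter i f x.
Proof.
move=> e; elim: q => [|q IHq]; first by rewrite muln0 addn0.
by rewrite mulnS addnA addnAC addnC iterD IHq -iterD addnC.
Qed.

Lemma normal_stable f x : normal_endo f ->
  exists2 N, (0 < N)%N & iter N f (iter N f x) = iter N f x.
Proof.
move=> nf; have [o o0 xo] := S_torsion x.
have /choice[z zP] n : exists z, iter n.+1 f x = f x * z /\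
    forall y, commute z y.
  by have [z] := normal_iter_central x n nf; exists z.
have zo n : z n ^+ o = 1.
  have [e cz] := zP n; have nM := np_morphl (normal_iter n.+1 nf).
  have X1 (h : S -> S) : {morph h : u v / u * v} -> h x ^+ o = 1.
    move=> hM; rewrite -(morph1 hM) -xo; elim: (o) => [|k IHk].
      by rewrite !expg0 morph1.
    by rewrite !expgS IHk hM.
  have := X1 _ nM; rewrite e expgMn; last exact/commute_sym.
  by rewrite X1 ?mul1g //; apply: np_morphl nf.
have [i [j [ij eij]]] : exists i j, (i < j)%N /\ z i = z j.
  apply: (finite_collision (S_center o0)) => n; split=> //.
  by case: (zP n).
have e : iter (i.+1 + (j - i)) f x = iter i.+1 f x.
  by rewrite addSn subnKC ?(ltnW ij) // (zP i).1 (zP j).1 eij.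
exists ((j - i) * i.+1)%N; first by rewrite muln_gt0 subn_gt0 ij.
have le : (i.+1 <= (j - i) * i.+1)%N by rewrite leq_pmull // subn_gt0.
have eK := subnK le.
by rewrite -iterD -{1}eK -addnA iterD iter_periodic // -iterD eK.
Qed.

(** On each point [f] is eventually periodic, and its Drazin inverse [g] acts
    there as [f] to the power [2 N - 1] for any large multiple [N] of the
    period. Then [f \o g] is the idempotent projecting onto the periodic points
    of [f], with kernel the points that [f] eventually kills; this replaces the
    Fitting decomposition, whose usual form fails since [x |-> x ^+ p] is onto
    but not injective on [Z/p^oo]. *)
Lemma normal_drazin f : normal_endo f ->
  exists g, [/\ normal_endo g, forall x, f (g x) = g (f x),
    forall x, g (f (g x)) = g x
    & forall x, exists n, iter n f (f (g x)) = iter n f x].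
Proof.
(* Factorials make the stages [T n] increasing, while every period and every
   pre-period is eventually covered. *)
move=> nf; pose T n := [set x | iter n`! f (iter n`! f x) = iter n`! f x].
pose f_ n := iter (n`! + n`!.-1) f.
have TqE n q x : T n x -> (0 < q)%N -> iter (n`! * q) f x = iter n`! f x.
  move=> Tx; case: q => // q _; rewrite mulnS; apply: iter_periodic.
  by rewrite iterD.
have fact_pred n : n`! = n`!.-1.+1 by rewrite prednK // fact_gt0.
have f_S n x : f (f_ n x) = iter (n`! + n`!) f x.
  by rewrite [in RHS](fact_pred n) addnS -(fact_pred n).
have T_le n m x : (n <= m)%N -> T n x -> T m x /\ f_ m x = f_ n x.
  move=> le_nm Tx; have [q mq] : exists q, m`! = (n`! * q)%N.
    by exists (\prod_(n.+1 <= k < m.+1) k)%N; apply: fact_split.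
  have q0 : (0 < q)%N by case: q mq (fact_gt0 m) => // ->; rewrite muln0.
  split; first by rewrite /T /= mq -iterD -mulnDr !TqE // addn_gt0 q0.
  have -> : f_ m = iter (n`!.-1 + n`! * (q + q).-1) f.
    congr (iter _ f); rewrite mq; apply: succn_inj.
    rewrite -addnS prednK; last by rewrite muln_gt0 fact_gt0.
    rewrite -addSn -fact_pred -mulnS prednK ?mulnDr //.
    by rewrite addn_gt0 q0.
  rewrite iterD TqE //; last by case: (q) q0 => // r _; rewrite addSn addnS.
  by rewrite -iterD addnC.
have Tall x : exists n, T n x.
  have [N N0 NE] := normal_stable x nf; exists N.
  have [q e] : exists q, N`! = (N * q)%N.
    by exists (N`! %/ N)%N; rewrite mulnC divnK // dvdn_fact // N0 leqnn.
  have q0 : (0 < q)%N by case: q e (fact_gt0 N) => // ->; rewrite muln0.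
  have Nq r : (0 < r)%N -> iter (N * r) f x = iter N f x.
    by case: r => // r _; rewrite mulnS; apply: iter_periodic; rewrite iterD.
  by rewrite /T /= e -iterD -mulnDr !Nq // addn_gt0 q0.
have [s sT] := choice Tall; pose g x := f_ (s x) x.
have gE n x : T n x -> g x = f_ n x.
  move=> Tx; rewrite -(T_le _ _ _ (leq_maxl n (s x)) Tx).2.
  by rewrite (T_le _ _ _ (leq_maxr n (s x)) (sT x)).2.
have nf_ n : normal_endo (f_ n) by apply: normal_iter.
have ng : normal_endo g.
  apply/normalP; exists (fun x => compl (f_ (s x)) x).
  apply: (normal_pair_limit nf_)
    => [n|n x Tx|//|n P phi x FP Px|n w x Ow|n x Tx].
  - have hM := np_morphl (normal_iter n`! nf).
    apply/subgroupP; split=> [|x y]; first by rewrite /T /= !(morph1 hM).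
    by rewrite /T /= !hM !(morphV hM) => -> ->.
  - by have [] := T_le _ _ _ (leqnSn n) Tx.
  - by apply: normal_fix_fmor FP Px; apply: normal_iter.
  - have hw y : iter n`! f (w y) = w (iter n`! f y).
      by apply: np_equivl => //; apply: normal_iter.
    by rewrite /T /= !hw => ->.
  - by rewrite (gE _ _ Tx); split=> //; rewrite /compl -/(g x) (gE _ _ Tx).
have fgE n x : T n x -> f (g x) = iter n`! f x.
  by move=> Tx; rewrite (gE _ _ Tx) f_S iterD.
exists g; split=> // x; have := sT x; set n := s x => Tx.
- have Tfx : T n (f x) by rewrite /T /= -!iterSr !iterS Tx.
  by rewrite (gE n x) // (gE n (f x)) // /f_ -iterSr.
- rewrite (fgE _ _ Tx) (gE n) ?(gE n x) //; last by rewrite /T /= Tx.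
  rewrite /f_ -iterD [(n`! + _)%N]addnC -addnA iterD (iterD n`! n`!) Tx.
  by rewrite -iterD.
- by exists n`!; rewrite (fgE _ _ Tx).
Qed.

End NormalPairs.

(** * The exchange argument *)

Section Exchange.
Variables (G : groupType) (N : set (G -> G)).
Implicit Types (f g h v d e q : G -> G).
Hypothesis N_morph : forall f, N f -> {morph f : x y / x * y}.
Hypothesis N_comm : forall f x y, N f -> commute (f x) (compl f y).
Hypothesis N_compl : forall f, N f -> N (compl f).
Hypothesis N_comp : forall f g, N f -> N g -> N (f \o g).
Hypothesis N_id : N id.
Hypothesis N_drazin : forall f, N f ->
  exists g, [/\ N g, forall x, f (g x) = g (f x),
    forall x, g (f (g x)) = g x
    & forall x, exists n, iter n f (f (g x)) = iter n f x].

Definition primitive d : Prop :=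
  [/\ N d, forall x, d (d x) = d x, exists x, d x <> 1
    & forall e, N e -> (forall x, e (e x) = e x) ->
        (forall x, d (e x) = e x) -> (forall x, e (d x) = e x) ->
        (forall x, e x = 1) \/ e =1 d].

(** This plays the role of the ring [d N d], and [corner_inv d g v] says
    that [v] is the inverse of [g] in it. *)
Definition corner d f : Prop :=
  [/\ N f, forall x, d (f x) = f x & forall x, f (d x) = f x].

Definition corner_inv d g v : Prop :=
  [/\ corner d v, forall x, v (g x) = d x & forall x, g (v x) = d x].

Lemma compl1 f y : f y = 1 -> compl f y = y.
Proof. by move=> e; rewrite /compl e invg1 mul1g. Qed.

Lemma iter_morph1 f n : N f -> iter n f 1 = 1.
Proof.
by move=> Nf; elim: n => //= n ->; apply: morph1 (N_morph Nf).
Qed.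

(** The corner of a primitive idempotent behaves as a local ring: the idempotent
    [g \o g'] given by the Drazin inverse [g'] is trivial or all of [d]. *)
Lemma primitive_dichotomy d g : primitive d -> corner d g ->
  (exists v, corner_inv d g v) \/ forall x, exists n, iter n g x = 1.
Proof.
move=> [Nd dd _ dprim] [Ng dg gd]; have [v [Nv gv vgv gn]] := N_drazin Ng.
have vd x : v (d x) = v x by rewrite -vgv gv gd -gv vgv.
have dv x : d (v x) = v x by rewrite -vgv -gv dg.
case: (dprim (g \o v)) => [||||triv|gvd] /=; first exact: N_comp.
- by move=> x /=; rewrite vgv.
- by move=> x /=; rewrite dg.
- by move=> x /=; rewrite vd.
- right=> x; have [n e] := gn x; exists n.
  by rewrite -e [g _]triv iter_morph1.
- by left; exists v; split=> // x; rewrite -?gv; apply: gvd.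
Qed.

Lemma nilpotent_kernel d g : primitive d -> corner d g ->
  (forall x, exists n, iter n g x = 1) ->
  exists y, [/\ d y = y, y <> 1 & g y = 1].
Proof.
move=> [_ dd [x dx] _] [_ dg _] gnil.
have ex : exists n, iter n g (d x) == 1.
  by have [n /eqP] := gnil (d x); exists n.
case: (ex_minnP ex) => -[|n] /eqP en nmin; first by case: dx.
exists (iter n g (d x)); split=> //; first by case: (n) => /=.
by move/eqP/nmin; rewrite ltnn.
Qed.

(** After multiplying by the inverse of the sum the two terms add up to [d]. If
    the first term kills [y], the second one fixes [y] and is not locally
    nilpotent. *)
Lemma corner_inv_add d g h f : primitive d -> corner d g -> corner d h ->
  (forall x, f x = g x * h x) -> (exists v, corner_inv d f v) ->
  (exists v, corner_inv d g v) \/ (exists v, corner_inv d h v).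
Proof.
move=> pd cg ch fE [v [[Nv dv vd] vf fv]].
have [|gnil] := primitive_dichotomy pd cg; first by left.
right; have [y [dy y1 gy]] := nilpotent_kernel pd cg gnil.
have [Nh dh hd] := ch.
have cvh : corner d (v \o h).
  by split=> [|x|x] /=; [apply: N_comp | rewrite dv | rewrite hd].
have vhy : v (h y) = y by rewrite -[h y]mul1g -gy -fE vf.
have [[w [[Nw _ _] wvh _]]|vhnil] := primitive_dichotomy pd cvh; last first.
  have [n e] := vhnil y; case: y1; rewrite -e.
  by elim: (n) => //= l <-.
have [//|hnil] := primitive_dichotomy pd ch.
have [z [dz z1 hz]] := nilpotent_kernel pd ch hnil.
by case: z1; rewrite -dz -wvh /= hz !morph1 //; apply: N_morph.
Qed.

Record decomposition k (e : 'I_k -> G -> G) : Prop := Decomposition {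
  dec_N : forall i, N (e i);
  dec_idem : forall i x, e i (e i x) = e i x;
  dec_orth : forall i j x, i != j -> e i (e j x) = 1;
  dec_total : forall x, (forall i, e i x = 1) -> x = 1
}.

(** Composites of complements take the place of partial sums of the projections:
    by [proj_compls], this is the sum of the [e i] with [i] not in [s]. *)
Definition compls k (e : 'I_k -> G -> G) (s : seq 'I_k) : G -> G :=
  foldr (fun i q => compl (e i) \o q) id s.

Section Decomposition.
Variables (k : nat) (e : 'I_k -> G -> G).
Hypothesis dec_e : decomposition e.

Lemma compls_N s : N (compls e s).
Proof.
elim: s => [|i s IHs]; first exact: N_id.
exact/N_comp/IHs/N_compl/dec_N.
Qed.

Lemma proj_compls i s x : e i (compls e s x) = if i \in s then 1 else e i x.
Proof.
have eM i' := N_morph (dec_N dec_e i').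
elim: s => [//|j s IHs]; rewrite inE /= {1}/compl eM (morphV (eM i)).
case: eqVneq => [->|ij] /=; first by rewrite dec_idem // mulVg.
by rewrite dec_orth // invg1 mul1g.
Qed.

Lemma compls_enum x : compls e (enum 'I_k) x = 1.
Proof.
by apply: (dec_total dec_e) => i; rewrite proj_compls mem_enum.
Qed.

(** The composite of all complements is trivial, and each complement changes a
    point by an element of [W]. *)
Lemma dec_generated (W : set G) : subgroup W ->
  (forall i x, W (e i x)) -> forall x, W x.
Proof.
move=> sW We x; have : W (compls e (enum 'I_k) x).
  by rewrite compls_enum; apply: subgroup1.
elim: (enum 'I_k) => //= i s IHs Wc; apply: IHs.
by rewrite -(mul_compl (e i) (compls e s x)); apply: subgroupM.
Qed.

(** Apply the complements of the [e i] one after the other. The corner of the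
    composite at [d] is invertible at the start and trivial at the end, and when
    its invertibility is lost at [e i] the other summand [d e_i d] must be
    invertible. *)
Lemma corner_inv_proj d : primitive d ->
  exists i v, corner_inv d (d \o e i \o d) v.
Proof.
move=> pd; have [Nd dd [x0 dx0] _] := pd; have dM := N_morph Nd.
have cd f : N f -> corner d (d \o f \o d).
  by move=> Nf; split=> [|x|x] /=; [do 2!apply: N_comp | |]; rewrite ?dd.
apply: contrapT => nex.
suff [v [[Nv _ _] vd _]] :
    exists v, corner_inv d (d \o compls e (enum 'I_k) \o d) v.
  by case: dx0; rewrite -vd /= compls_enum !morph1 //; apply: N_morph.
elim: (enum 'I_k) (enum_uniq 'I_k) => [_|i s IHs /= /andP[i's us]].
  exists d; split; [split=> // x; exact: dd|by move=> x /=; rewrite !dd..].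
have /= := @corner_inv_add d (d \o e i \o d) (d \o compls e (i :: s) \o d)
  (d \o compls e s \o d) pd (cd _ (dec_N dec_e i)) (cd _ (compls_N _)).
case=> // [x||].
- rewrite /= -dM; congr (d _); rewrite -[LHS](mul_compl (e i)).
  by rewrite proj_compls (negPf i's).
- exact: IHs.
- by move=> h; case: nex; exists i.
Qed.

End Decomposition.

(** The exchange step. The endomorphism [compl (compl e \o d)] is the sum of
    [e] on the image of [d] and of the identity on its kernel; written through
    complements it visibly belongs to [N]. It is onto the image of [e] because
    the idempotent [e v e] is below [e] and nontrivial, hence equal to [e]. *)
Lemma exchange d e v : primitive d -> primitive e ->
  corner_inv d (d \o e \o d) v ->
  exists a, [/\ N a, forall x, a x = 1 -> x = 1, forall x, d x = 1 -> a x = x,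
    forall x, a (d x) = e (d x) & forall x, exists y, e x = a (d y)].
Proof.
move=> [Nd dd [x0 dx0] _] [Ne ee _ eprim] [[Nv dv vd] vg _].
have [[dM eM] vM] := (N_morph Nd, N_morph Ne, N_morph Nv).
have ved x : v (e (d x)) = d x by rewrite -vd; apply: vg.
pose q := e \o v \o e.
have qE x : e (v (e x)) = e x.
  have [||||triv|qe] := eprim q.
  - by apply: N_comp => //; apply: N_comp.
  - by move=> y; rewrite /q /= ee -[v (e y)]dv ved.
  - by move=> y; rewrite /q /= ee.
  - by move=> y; rewrite /q /= ee.
  - have edx y : e (d y) = 1 by rewrite -[RHS](triv (d y)) /q /= ved.
    by case: dx0; rewrite -ved edx (morph1 vM).
  - exact: qe.
pose a := compl (compl e \o d); have ad x : a (d x) = e (d x).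
  rewrite /a {1}/compl /= dd; apply: (@mulgI _ (compl e (d x))).
  by rewrite mulVKg -(N_comm (d x) (d x) Ne) mul_compl.
have a1 x : d x = 1 -> a x = x.
  move=> dx; rewrite /a {1}/compl /= dx (morph1 (N_morph (N_compl Ne))).
  by rewrite invg1 mul1g.
have Na : N a by apply/N_compl/N_comp/Nd/N_compl.
exists a; split=> // x => [ax|]; last by exists (v (e x)); rewrite ad dv qE.
have e1 : d x = 1.
  have dax : a x = e (d x) * compl d x.
    rewrite -{1}(mul_compl d x) (N_morph Na) ad a1 //.
    by rewrite /compl dM (morphV dM) dd mulVg.
  rewrite -[LHS]vg /= -(morph1 vM) -(morph1 dM) -ax dax dM; congr v.
  by rewrite /compl dM (morphV dM) dd mulVg mulg1.
by rewrite -(a1 x e1).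
Qed.

(** An injective [f] is onto: cancel [f^n] in the equation satisfied by the
    Drazin inverse. *)
Lemma N_inj_inverse f : N f -> (forall x, f x = 1 -> x = 1) ->
  exists g, [/\ N g, cancel f g & cancel g f].
Proof.
move=> Nf fker; have [g [Ng gf _ gn]] := N_drazin Nf.
have finj x y : f x = f y -> x = y.
  move=> e; apply: (@mulIg _ y^-1); rewrite mulgV; apply: fker.
  by rewrite (N_morph Nf) (morphV (N_morph Nf)) e mulgV.
have fgK : cancel g f.
  move=> x; have [n] := gn x; elim: n => //= n IHn /finj.
  exact: IHn.
by exists g; split=> // x; rewrite -gf.
Qed.

Lemma primitive_conj d a b : N a -> N b -> cancel a b -> cancel b a ->
  primitive d -> primitive (a \o d \o b).
Proof.
move=> Na Nb aK bK [Nd dd [x0 dx0] dprim].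
have Nconj u u' f : N u -> N u' -> N f -> N (u \o f \o u').
  by move=> Nu Nu' Nf; do 2!apply: N_comp => //.
split=> [|x||f Nf ff df fd].
- exact: Nconj.
- by rewrite /= aK dd.
- exists (a x0) => /=; rewrite aK => e; case: dx0.
  by rewrite -(aK (d x0)) e (morph1 (N_morph Nb)).
have [||||triv|fE] := dprim (b \o f \o a).
- exact: Nconj.
- by move=> x /=; rewrite bK ff.
- by move=> x; apply: (can_inj aK); rewrite /= bK; apply: df.
- by move=> x; have := fd (a x); rewrite /= aK => ->.
- left=> x; rewrite -(bK (f x)) -(bK x) [b _]triv.
  exact: morph1 (N_morph Na).
- by right=> x; rewrite -(bK (f x)) -{1}(bK x) [b _]fE.
Qed.

Section Uniqueness.
Variables (k m : nat) (d : 'I_k -> G -> G) (e : 'I_m -> G -> G).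
Hypotheses (dec_d : decomposition d) (dec_e : decomposition e).
Hypotheses (prim_d : forall i, primitive (d i)).
Hypotheses (prim_e : forall j, primitive (e j)).

(** The step for [i0] uses the conjugate idempotent [a d_i0 b]. It kills the
    images [a (d_i S)] that are already in place, so the new automorphism fixes
    them. *)
Lemma exchange_first r : (r <= k)%N ->
  exists a b, [/\ N a, N b, cancel a b, cancel b a
    & forall i : 'I_k, (i < r)%N ->
        exists j, a @` range (d i) = range (e j)].
Proof.
elim: r => [_|r IHr rk]; first by exists id, id; split.
have [a [b [Na Nb aK bK aE]]] := IHr (ltnW rk).
pose i0 := Ordinal rk; have pD := primitive_conj Na Nb aK bK (prim_d i0).
have [j [v inv_v]] := corner_inv_proj dec_e pD.
have [c [Nc cker cfix cD eD]] := exchange pD (prim_e j) inv_v.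
have [c' [Nc' cK c'K]] := N_inj_inverse Nc cker.
exists (c \o a), (b \o c'); split; [exact: N_comp|exact: N_comp|..].
- by move=> x /=; rewrite cK aK.
- by move=> x /=; rewrite bK c'K.
move=> i; rewrite ltnS leq_eqVlt => /predU1P[ir|ir].
  have -> : i = i0 by apply: val_inj.
  exists j; apply/seteqP; split=> [_ [_ [x _ <-] <-]|_ [x _ <-]].
    exists (a (d i0 x)) => //=.
    by have := cD (a x); rewrite /= aK => ->.
  have [y ->] := eD x; by exists (d i0 (b y)); first by exists (b y).
have [j' aE'] := aE i ir; exists j'; rewrite -aE'.
have fixed x : c (a (d i x)) = a (d i x).
  apply: cfix; rewrite /= aK dec_orth //; first exact: morph1 (N_morph Na).
  by rewrite -val_eqE /= gtn_eqF.
apply/seteqP; split=> _ [_ [x _ <-] <-].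
  by exists (d i x); [exists x|rewrite /= fixed].
by exists (d i x); [exists x|rewrite /= fixed].
Qed.

(** If [e j] were missed, it would kill all [a (d_i S)], which generate the
    group. *)
Lemma krull_remak_schmidt :
  exists a b (s : 'I_k -> 'I_m), [/\ N a /\ N b, cancel a b, cancel b a,
    bijective s & forall i, a @` range (d i) = range (e (s i))].
Proof.
have [a [b [Na Nb aK bK aE]]] := exchange_first (leqnn k).
have /choice[s sE] i : exists j, a @` range (d i) = range (e j).
  by apply: aE.
exists a, b, s; split=> //.
have s_inj : injective s.
  move=> i i' es; have [_ dd [x dx] _] := prim_d i.
  have : (a @` range (d i')) (a (d i x)).
    by rewrite sE -es -sE; exists (d i x) => //; exists x.
  case=> _ [y _ <-] /(can_inj aK) ey; apply/eqP/contraT => ii'.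
  by case: dx; rewrite -dd -ey dec_orth.
have s_surj j : exists i, s i = j.
  apply: contrapT => nex; have [Ne _ [x []]] := prim_e j.
  rewrite -(bK x); move: (b x) => {}x; move: x.
  apply: (dec_generated dec_d) => [|i x].
    apply/subgroupP; split=> [|x y].
      by rewrite (morph1 (N_morph Na)) (morph1 (N_morph Ne)).
    rewrite (N_morph Na) (N_morph Ne) (morphV (N_morph Na)).
    by rewrite (morphV (N_morph Ne)) => -> ->; rewrite mulgV.
  have : range (e (s i)) (a (d i x)).
    by rewrite -sE; exists (d i x) => //; exists x.
  case=> y _ <-; rewrite dec_orth //; apply/eqP => ej.
  by case: nex; exists i.
have [t tK] := choice s_surj.
by exists t => [i|j]; [apply: s_inj; rewrite tK|apply: tK].
Qed.

End Uniqueness.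


End Exchange.

(** * Morphisms of fusion systems *)

Section MorCriterion.
Variables (G H : groupType) (E : system G) (F : system H) (f : G -> H).

(** The functor of a morphism is determined by [f], and its functoriality
    follows from its values. *)
Lemma Mor_intro :
  (forall P Q phi psi, Hom E P Q phi -> {in P, phi =1 psi} -> Hom E P Q psi) ->
  (forall P, object E P -> Hom E P P id) ->
  (forall P Q R phi psi, Hom E P Q phi -> Hom E Q R psi ->
     Hom E P R (psi \o phi)) ->
  (forall P Q phi x, Hom E P Q phi -> P x -> Q (phi x)) ->
  group_hom (base E) (base F) f ->
  (forall P Q phi, Hom E P Q phi ->
     exists2 psi, Hom F (f @` P) (f @` Q) psi
       & forall x, P x -> psi (f x) = f (phi x)) ->
  Mor E F f.
Proof.
move=> Eext Eid Ecomp Efun fM fhatP; split=> //.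
have /choice[fhat hatP] (t : set G * set G * (G -> G)) :
    exists psi, Hom E t.1.1 t.1.2 t.2 ->
      Hom F (f @` t.1.1) (f @` t.1.2) psi /\
      forall x, t.1.1 x -> psi (f x) = f (t.2 x).
  have [/fhatP[psi]|nE] := pselect (Hom E t.1.1 t.1.2 t.2).
    by exists psi.
  by exists (fun=> 1).
pose fh P Q phi := fhat (P, Q, phi).
have hF P Q phi : Hom E P Q phi -> Hom F (f @` P) (f @` Q) (fh P Q phi).
  by move=> Ephi; case: (hatP (P, Q, phi) Ephi).
have hE P Q phi x : Hom E P Q phi -> P x -> fh P Q phi (f x) = f (phi x).
  by move=> Ephi Px; have [_ hx] := hatP (P, Q, phi) Ephi; apply: hx.
exists fh; split=> //.
- move=> P Q phi psi Ephi e _ /set_mem[x Px <-].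
  rewrite !hE //; first by rewrite e //; apply: mem_set.
  exact: Eext e.
- by move=> P oP _ /set_mem[x Px <-]; rewrite hE //; apply: Eid.
- move=> P Q R phi psi Ephi Epsi _ /set_mem[x Px <-] /=.
  rewrite (hE _ _ _ _ _ Px); last exact: Ecomp Epsi.
  by rewrite (hE _ _ _ _ Ephi Px) (hE _ _ _ _ Epsi (Efun _ _ _ _ Ephi Px)).
- by move=> P Q phi Ephi x /set_mem Px; rewrite hE.
Qed.

Lemma Mor_hat P Q phi : Mor E F f -> Hom E P Q phi ->
  exists2 psi, Hom F (f @` P) (f @` Q) psi
    & forall x, P x -> psi (f x) = f (phi x).
Proof.
move=> [_ [fhat hatf]] Ephi; exists (fhat P Q phi).
  exact: hat_hom hatf _ _ _ Ephi.
by move=> x Px; apply: (hat_eq hatf) => //; apply: mem_set.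
Qed.

End MorCriterion.

Lemma Mor_intro_fusion (G H : groupType) (E : system G) (F : system H) f :
  fusion_system E -> group_hom (base E) (base F) f ->
  (forall P Q phi, Hom E P Q phi ->
     exists2 psi, Hom F (f @` P) (f @` Q) psi
       & forall x, P x -> psi (f x) = f (phi x)) ->
  Mor E F f.
Proof.
move=> fE; apply: Mor_intro.
- by move=> P Q phi psi; apply: fusion_ext.
- by move=> P oP; apply: Hom_incl.
- by move=> P Q R phi psi; apply: fusion_comp.
- by move=> P Q phi x; apply: Hom_fun.
Qed.

Section MorProduct.
Variables (G H : groupType) (k : nat) (E : 'I_k -> system G) (F : system H).
Hypothesis E_fusion : forall i, fusion_system (E i).

Lemma pr_subgroup i (P : set {ffun 'I_k -> G}) : subgroup P ->
  subgroup (pr i P).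
Proof.
move=> sP; apply: (@subgroup_image _ _ P (fun x => x i)) => //.
by move=> x y _ _ /=; rewrite ffunE.
Qed.

Lemma Mor_intro_product f :
  group_hom (product_base E) (base F) f ->
  (forall P Q phi, subgroup P -> subgroup Q -> P `<=` product_base E ->
     Q `<=` product_base E ->
     (forall i, Hom (E i) (pr i P) (pr i Q) (phi i)) ->
     (forall x, P x -> Q (prod_map phi x)) ->
     exists2 psi, Hom F (f @` P) (f @` Q) psi
       & forall x, P x -> psi (f x) = f (prod_map phi x)) ->
  Mor (direct_product E) F f.
Proof.
move=> fM fP; apply: Mor_intro => //.
- move=> P Q phi psi [obj [th [Eth PQ e]]] e'; split=> //.
  exists th; split=> //.
  by move=> x Px; rewrite -e' // e.
- move=> P [sP PE]; split=> //; exists (fun=> id).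
  have idE (x : {ffun 'I_k -> G}) : prod_map (fun=> id) x = x.
    by apply/ffunP => i; rewrite ffunE.
  split=> [i|x Px|x _]; rewrite ?idE //.
  apply: Hom_incl => //; split; try exact: pr_subgroup.
    by move=> _ [x Px <-]; apply: PE.
  by move=> _ [x Px <-]; apply: PE.
- move=> P Q R phi psi [[sP PE sQ QE] [th [Eth PQ e]]].
  move=> [[_ _ sR RE] [th' [Eth' QR e']]]; split=> //.
  exists (fun i => th' i \o th i).
  have compE (x : {ffun 'I_k -> G}) :
      prod_map (fun i => th' i \o th i) x = prod_map th' (prod_map th x).
    by apply/ffunP => i; rewrite !ffunE.
  split=> [i|x Px|x Px]; rewrite ?compE.
  + exact: fusion_comp (Eth i) (Eth' i).
  + exact/QR/PQ.
  + by rewrite /= e // e' //; apply/mem_set/PQ/set_mem.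
- move=> P Q phi x [_ [th [_ PQ e]]] Px.
  by rewrite e; [apply: PQ|apply: mem_set].
move=> P Q phi [[sP PE sQ QE] [th [Eth PQ e]]].
have [psi Fpsi psiE] := fP P Q th sP sQ PE QE Eth PQ.
by exists psi => // x Px; rewrite psiE // e //; apply: mem_set.
Qed.

End MorProduct.

(** * Direct decompositions and idempotents *)

Section ProductIdempotents.
Variables (S : groupType) (F : system S) (k : nat) (E : 'I_k -> system S).
Hypothesis F_fusion : fusion_system F.
Hypothesis F_base : base F = [set: S].
Hypothesis E_sub : forall i, subsystem (E i) F.
Hypothesis E_prod : is_direct_product F E.
Let E_fusion i : fusion_system (E i) := (E_sub i).1.

Let E1 i : base (E i) 1.
Proof. exact: subgroup1 (fusion_base (E_fusion i)). Qed.

(** The map [e i] is the [i]-th component of the inverse of the multiplication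
    isomorphism. In these terms a morphism of [F] is the same as a family of
    morphisms of the factors [E i], one for each coordinate; these are the last
    two clauses. *)
Lemma product_coordinates : exists e : 'I_k -> S -> S,
  [/\ forall i, {morph e i : x y / x * y},
      forall i, range (e i) = base (E i),
      forall i j x, base (E j) x -> e i x = if i == j then x else 1,
      forall x y, (forall i, e i x = e i y) -> x = y
    & [/\ forall P phi i, fmor F P phi ->
        exists2 th, Hom (E i) (e i @` P) (base (E i)) th
          & forall x, P x -> th (e i x) = e i (phi x)
      & forall R th, subgroup R ->
        (forall i, Hom (E i) (e i @` R) (base (E i)) (th i)) ->
        exists2 psi, fmor F R psi
          & forall r i, R r -> e i (psi r) = th i (e i r)]].
Proof.
have [I [_ IMor Ifac] [_ [J JMor [IK JK]]]] := E_prod.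
have JM : {morph J : x y / x * y}.
  by move=> x y; case: JMor => -[_ + _]; apply; rewrite F_base inE.
have JT x : product_base E (J x).
  by case: JMor => -[+ _] _; apply; rewrite F_base.
have {}JK x : I (J x) = x by apply: JK; rewrite F_base inE.
have {}IK y : product_base E y -> J (I y) = y by move/mem_set/IK.
have Jfac j x : base (E j) x -> J x = Defs.factor_inj j x.
  move=> Tx; rewrite -{1}(Ifac j x) ?IK //; last exact: mem_set.
  by move=> i; rewrite ffunE; case: eqVneq => [->|].
pose e i x := J x i.
have eM i : {morph e i : x y / x * y} by move=> x y; rewrite /e JM ffunE.
have eT i j x : base (E j) x -> e i x = if i == j then x else 1.
  by move=> Tx; rewrite /e (Jfac j) // ffunE.
have e_range i : range (e i) = base (E i).
  apply/seteqP; split=> [_ [x _ <-]|x Tx]; first exact: JT.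
  by exists x => //; rewrite (eT i i) // eqxx.
have prE i (P : set S) : pr i (J @` P) = e i @` P.
  apply/seteqP; split=> [_ [_ [x Px <-] <-]|_ [x Px <-]]; first by exists x.
  by exists (J x) => //; exists x.
exists e; split=> //.
  by move=> x y exy; rewrite -(JK x) -(JK y); congr I; apply/ffunP.
split=> [P phi i Fphi|R th sR Eth].
  have [psi [_ [th [Eth _ psiE]]] hpsi] := Mor_hat JMor Fphi.
  exists (th i); first by have := Eth i; rewrite !prE e_range.
  move=> x Px; rewrite /e -hpsi // psiE ?ffunE //.
  by apply: mem_set; exists x.
have sB : subgroup (product_base E).
  apply/subgroupP; split=> [i|x y Bx By i]; rewrite !ffunE //.
  have sT := fusion_base (E_fusion i).
  by apply: subgroupM => //; apply: subgroupV.
have prB i : pr i (product_base E) = base (E i).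
  apply/seteqP; split=> [_ [y By <-]|x Tx]; first exact: By.
  exists (Defs.factor_inj i x); last by rewrite ffunE eqxx.
  by move=> j; rewrite ffunE; case: eqVneq => [->|].
have thB x : R x -> product_base E (prod_map th (J x)).
  move=> Rx i; rewrite ffunE; apply: (Hom_fun (E_fusion i) (Eth i)).
  by exists x.
have Dth : Hom (direct_product E) (J @` R) (product_base E) (prod_map th).
  split.
    split=> //; last by move=> _ [x _ <-].
    by apply: subgroup_image => // x y _ _.
  exists th; split=> // [i|_ [x Rx <-]]; last exact: thB.
  by rewrite prE prB.
have [psi Fpsi psiE] := Mor_hat IMor Dth.
have IJR : I @` (J @` R) = R.
  apply/seteqP; split=> [_ [_ [x Rx <-] <-]|x Rx]; first by rewrite JK.
  by exists (J x); [exists x|].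
exists psi => [|r i Rr].
  by have := fmor_Hom F_fusion F_base Fpsi; rewrite IJR.
have := psiE (J r) (ex_intro2 _ _ r Rr erefl); rewrite JK => ->.
by rewrite /e IK ?ffunE //; apply: thB.
Qed.

Lemma compl_morph (f : S -> S) : {morph f : x y / x * y} ->
  (forall x y, commute (f x) (compl f y)) ->
  {morph compl f : x y / x * y}.
Proof.
move=> fM fC x y; have cx := commuteV (commute_sym (fC y x)).
transitivity ((f y)^-1 * compl f x * y).
  by rewrite /compl fM invgM !mulgA.
by rewrite -cx /compl !mulgA.
Qed.

(** The projections are normal because [e i] and its complement project onto
    complementary partial products of the factors: combine the [i]-th component
    of the first morphism with the other components of the second one. *)
Lemma product_idempotents0 : exists e : 'I_k -> S -> S,
  [/\ decomposition (normal_endo F set0) e,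
      forall i, range (e i) = base (E i),
      forall i j x, base (E j) x -> e i x = if i == j then x else 1
    & forall i, E i = full F (base (E i))].
Proof.
have [e [eM e_range eT e_inj [eF Fe]]] := product_coordinates.
have ee i j x : e i (e j x) = if i == j then e j x else 1.
  by apply: eT; rewrite -e_range; exists x.
have ecompl i j x : e i (compl (e j) x) = if i == j then 1 else e i x.
  rewrite /compl eM (morphV (eM i)) ee; case: eqVneq => [->|_].
    by rewrite mulVg.
  by rewrite invg1 mul1g.
have eC i x y : commute (e i x) (compl (e i) y).
  apply: e_inj => j; rewrite (eM j (e i x)) (eM j _ (e i x)) ee ecompl.
  by case: eqP => _; rewrite ?mulg1 ?mul1g.
have ne i : normal_endo F set0 (e i).
  split=> //; [exact: compl_morph|exact: mul_compl|].
  move=> P Q phi psi Fphi Fpsi.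
  have /choice[th1 th1P] j : exists th, Hom (E j) (e j @` P) (base (E j)) th /\
      forall x, P x -> th (e j x) = e j (phi x).
    by have [th] := eF _ _ j Fphi; exists th.
  have /choice[th2 th2P] j : exists th, Hom (E j) (e j @` Q) (base (E j)) th /\
      forall x, Q x -> th (e j x) = e j (psi x).
    by have [th] := eF _ _ j Fpsi; exists th.
  have [sP sQ] := (fmor_subgroup F_fusion Fphi, fmor_subgroup F_fusion Fpsi).
  set R := mulset (e i @` P) (compl (e i) @` Q).
  have sR : subgroup R.
    apply: subgroup_mulset.
    + by apply: subgroup_image => //; apply: morph_morph_on.
    + apply: subgroup_image => //; apply: morph_morph_on.
      exact: compl_morph.
    + by move=> _ _ [x _ <-] [y _ <-].
  have eR j x y : e j (e i x * compl (e i) y) = if j == i then e j x else e j y.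
    by rewrite eM ee ecompl; case: eqVneq => [->|_]; rewrite ?mulg1 ?mul1g.
  have Rxy x y : P x -> Q y -> R (e i x * compl (e i) y).
    move=> Px Qy; exists (e i x); first by exists x.
    by exists (compl (e i) y) => //; exists y.
  have eRE j : e j @` R = if j == i then e j @` P else e j @` Q.
    apply/seteqP; split=> [_ [_ [_ [x Px <-] [_ [y Qy <-] <-]] <-]|].
      by rewrite eR; case: eqP => _; [exists x|exists y].
    case: eqVneq => [->|ji] _ [x Px <-].
      exists (e i x * compl (e i) 1); last by rewrite eR eqxx.
      by apply: Rxy => //; apply: subgroup1.
    exists (e i 1 * compl (e i) x); last by rewrite eR (negPf ji).
    by apply: Rxy => //; apply: subgroup1.
  pose th j := if j == i then th1 j else th2 j.
  have [||psi' Fpsi' psiE] := Fe R th => //.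
    move=> j; rewrite eRE /th; case: eqP => _; first by case: (th1P j).
    by case: (th2P j).
  exists psi' => // x y Px Qy; apply: e_inj => j.
  rewrite psiE; last exact: Rxy.
  rewrite !eR /th; case: eqP => _; first by rewrite (th1P j).2.
  by rewrite (th2P j).2.
exists e; split=> //.
  split=> // [i x|i j x|x e1]; [by rewrite ee eqxx|by rewrite ee => /negPf->|].
  by apply: e_inj => i; rewrite e1 (morph1 (eM i)).
move=> i; have [fE [TF EF]] := E_sub i.
suff eH : Hom (full F (base (E i))) = Hom (E i).
  transitivity (System (base (E i)) (Hom (E i))); first by case: (E i).
  by rewrite -eH.
apply: funext => P; apply: funext => Q; apply/seteqP.
split=> phi /=; last first.
  move=> Ephi; have [[_ PT] [_ QT]] := fusion_object fE Ephi.
  by split=> //; apply: EF.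
case=> PT QT Fphi; have [sP sQ] := Hom_subgroup F_fusion Fphi.
have [th Eth thE] := eF _ _ i (fmor_Hom F_fusion F_base Fphi).
have eid x : base (E i) x -> e i x = x by move/(eT i i)->; rewrite eqxx.
have ePP : e i @` P = P.
  apply/seteqP; split=> [_ [x Px <-]|x Px]; first by rewrite eid //; apply: PT.
  by exists x; rewrite ?eid //; apply: PT.
have PQ x : P x -> Q (phi x) by apply: Hom_fun Fphi.
rewrite ePP in Eth; apply: (Hom_target fE (Q := base (E i))) (PQ) => //.
apply: (fusion_ext fE Eth) => x /set_mem Px.
by have := thE x Px; rewrite !eid //; [apply/QT/PQ|apply: PT].
Qed.

Variable Omega : set (S -> S).
Hypothesis Omega_morph : forall w, Omega w -> {morph w : x y / x * y}.
Hypothesis Omega_base : forall w i, Omega w -> w @` base (E i) = base (E i).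

(** An operator preserves each factor, hence commutes with the projections on
    each factor, and the factors generate the group. *)
Lemma product_idempotents : exists e : 'I_k -> S -> S,
  [/\ decomposition (normal_endo F Omega) e,
      forall i, range (e i) = base (E i)
    & forall i, E i = full F (base (E i))].
Proof.
have [e [dec_e e_range eT eE]] := product_idempotents0.
have morph0 w : set0 w -> {morph (w : S -> S) : x y / x * y} by [].
exists e; split=> //.
have ne i := dec_N dec_e i; have eM i := np_morphl (ne i).
have ew i w x : Omega w -> e i (w x) = w (e i x).
  move=> Ow; have wM := Omega_morph Ow; move: x.
  have wT j x : base (E j) x -> base (E j) (w x).
    by move=> Tx; rewrite -(Omega_base j Ow); exists x.
  apply: (dec_generated (N := normal_endo F set0) _ dec_e
    (W := [set x | e i (w x) = w (e i x)])).
  - by move=> f /np_morphl.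
  - apply/subgroupP; split=> [|x y].
      by rewrite /= (morph1 wM) (morph1 (eM i)) (morph1 wM).
    rewrite /= !(wM, eM) (morphV wM) !(morphV (eM i)) (morphV wM).
    by move=> -> ->.
  - move=> j x; have Tx : base (E j) (e j x) by rewrite -e_range; exists x.
    rewrite /= (eT i j (w _)); last exact: wT.
    by rewrite (eT i j (e j x)) //; case: eqP => // _; rewrite (morph1 wM).
split; [|exact: dec_idem dec_e|exact: dec_orth dec_e|exact: dec_total dec_e].
move=> i; case: (ne i) => *; split=> // w x Ow; first exact: ew.
by have wM := Omega_morph Ow; rewrite /compl ew // wM (morphV wM).
Qed.

End ProductIdempotents.

(** * Full subsystems and automorphisms *)

Section Functorial.
Variables (S : groupType) (F : system S).
Hypothesis F_fusion : fusion_system F.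
Hypothesis F_base : base F = [set: S].
Implicit Types (P Q T : set S) (a b f phi : S -> S).

(** The functor attached to [f], without its targets *)
Definition functorial f : Prop := forall P phi, fmor F P phi ->
  exists2 psi, fmor F (f @` P) psi & forall x, P x -> psi (f x) = f (phi x).

Lemma End_functorial f : End F f -> {morph f : x y / x * y} /\ functorial f.
Proof.
move=> Ff; split=> [x y|P phi Fphi].
  by have [[_ fM] _] := Ff; apply: fM; rewrite F_base inE.
by have [psi /(fmor_Hom F_fusion F_base)] := Mor_hat Ff Fphi; exists psi.
Qed.

Lemma functorial_End f : {morph f : x y / x * y} -> functorial f -> End F f.
Proof.
move=> fM ff; apply: Mor_intro_fusion => //.
  by split=> [x _|x y _ _]; rewrite ?F_base.
move=> P Q phi Fphi.
have [psi Fpsi psiE] := ff _ _ (fmor_Hom F_fusion F_base Fphi).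
exists psi => //; apply/(HomE F_fusion F_base); split=> //.
  have [_ sQ] := Hom_subgroup F_fusion Fphi.
  by apply: subgroup_image => //; apply: morph_morph_on.
move=> _ [x Px <-]; rewrite psiE //; exists (phi x) => //.
exact: Hom_fun Fphi Px.
Qed.

(** Morphisms are transported by [a] and, in the other direction, by [b]. *)
Lemma hat_image_full a b T : {morph a : x y / x * y} ->
  {morph b : x y / x * y} -> functorial a -> functorial b ->
  cancel a b -> cancel b a -> hat_image a (full F T) = full F (a @` T).
Proof.
move=> aM bM fa fb aK bK; rewrite /hat_image /full; congr System.
apply: funext => P'; apply: funext => Q'; apply/seteqP; split=> psi.
  move=> [P [Q [phi [[PT QT Fphi] -> -> e]]]].
  have [sP sQ] := Hom_subgroup F_fusion Fphi.
  split; try exact: image_subset.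
  have [psi' Fpsi' psiE] := fa _ _ (fmor_Hom F_fusion F_base Fphi).
  apply/(HomE F_fusion F_base); split.
  - apply: (fmor_ext F_fusion Fpsi') => _ [x Px <-].
    by rewrite psiE // e //; apply: mem_set.
  - by apply: subgroup_image => //; apply: morph_morph_on.
  move=> _ [x Px <-]; rewrite e; last exact: mem_set.
  by exists (phi x) => //; apply: Hom_fun Fphi Px.
case=> PT QT Fpsi; have [sP sQ] := Hom_subgroup F_fusion Fpsi.
have [phi Fphi phiE] := fb _ _ (fmor_Hom F_fusion F_base Fpsi).
have abI R : R = a @` (b @` R).
  apply/seteqP; split=> [x Rx|_ [_ [x Rx <-] <-]]; last by rewrite bK.
  by exists (b x); [exists x|].
have bT R : R `<=` a @` T -> b @` R `<=` T.
  by move=> RT _ [x /RT[y Ty <-] <-]; rewrite aK.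
exists (b @` P'), (b @` Q'), phi; split=> //.
  split; try exact: bT.
  apply/(HomE F_fusion F_base); split=> //.
    by apply: subgroup_image => //; apply: morph_morph_on.
  move=> _ [x Px <-]; rewrite phiE //; exists (psi x) => //.
  exact: Hom_fun Fpsi Px.
by move=> _ /set_mem[x Px <-]; rewrite phiE // !bK.
Qed.

End Functorial.

Section Indecomposable.
Variables (S : groupType) (F : system S) (Omega : set (S -> S)).
Hypothesis F_fusion : fusion_system F.
Hypothesis F_base : base F = [set: S].
Hypothesis Omega_sub : Aut_subgroup F Omega.

Lemma Omega_morph w : Omega w -> {morph w : x y / x * y}.
Proof.
have [OA _ _ _] := Omega_sub.
by move=> /OA[Fw _]; have [] := End_functorial F_fusion F_base Fw.
Qed.

Lemma Omega_inverse w : Omega w ->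
  exists w', [/\ Omega w', cancel w w' & cancel w' w].
Proof.
have [_ _ _ Oinv] := Omega_sub => /Oinv[w' Ow' [wK w'K]].
by exists w'; split=> // x; [apply: wK|apply: w'K]; rewrite F_base inE.
Qed.

Lemma Omega_functorial w : Omega w -> functorial F w.
Proof.
have [OA _ _ _] := Omega_sub.
by move=> /OA[Fw _]; have [] := End_functorial F_fusion F_base Fw.
Qed.

Lemma Omega_invariant_full f : normal_endo F Omega f ->
  Omega_invariant Omega (full F (range f)).
Proof.
move=> nf w Ow; have [w' [Ow' wK w'K]] := Omega_inverse Ow.
have wM := Omega_morph Ow; have w'M := Omega_morph Ow'.
rewrite (hat_image_full F_fusion F_base _ wM w'M _ _ wK w'K);
  try exact: Omega_functorial.
congr full; apply/seteqP; split=> [_ [_ [y _ <-] <-]|_ [x _ <-]].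
  by exists (w y) => //; apply: (np_equivl nf).
exists (f (w' x)); first by exists (w' x).
by rewrite -[RHS](f_equal f (w'K x)); apply/esym/(np_equivl nf).
Qed.

Lemma subsystem_full_full T T' : subgroup T -> T `<=` T' ->
  subsystem (full F T) (full F T').
Proof.
move=> sT TT'; have [fT _] := subsystem_full F_fusion F_base sT.
split=> //; split=> // P Q phi [PT QT Fphi].
by split=> //; apply: subset_trans TT'.
Qed.

Lemma ord2P (i : 'I_2) : i = ord0 \/ i = ord_max.
Proof. by case: i => -[|[|//]] i2; [left|right]; apply: val_inj. Qed.

(** Multiplication is a morphism to the full subsystem on the image of [e] by
    [np_fmor] for [f], whose complement fixes the image of [g]; the pair
    [f], [g] gives its inverse. *)
Lemma full_is_direct_product e f g :
  normal_endo F Omega f -> normal_endo F Omega g ->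
  (forall x, f (f x) = f x) -> (forall x, g (g x) = g x) ->
  (forall x, f (g x) = 1) -> (forall x, g (f x) = 1) ->
  {morph e : x y / x * y} -> (forall x, e (e x) = e x) ->
  (forall x, f x * g x = e x) ->
  (forall x, e (f x) = f x) -> (forall x, e (g x) = g x) ->
  is_direct_product (full F (range e))
    (tnth [tuple full F (range f); full F (range g)]).
Proof.
move=> nf ng ff gg fg gf eM ee fgE ef eg.
set T := range e; pose D := tnth [tuple full F (range f); full F (range g)].
have [fM gM] := (np_morphl nf, np_morphl ng).
have Dsub i : subsystem (D i) (full F T).
  case: (ord2P i) => ->; apply: subsystem_full_full; try exact: subgroup_range.
    by move=> _ [x _ <-]; exists (f x).
  by move=> _ [x _ <-]; exists (g x).
have Dfus i := (Dsub i).1.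
pose I (y : {ffun 'I_2 -> S}) := y ord0 * y ord_max.
pose J x : {ffun 'I_2 -> S} := [ffun i => if i == ord0 then f x else g x].
have J0 x : J x ord0 = f x by rewrite ffunE.
have J1 x : J x ord_max = g x by rewrite ffunE.
have fix0 x : range f x -> f x = x by case=> y _ <-.
have fix1 x : range g x -> compl f x = x by case=> y _ <-; rewrite compl1.
have B0 y : product_base D y -> range f (y ord0) by move=> By; apply: (By ord0).
have B1 y : product_base D y -> range g (y ord_max).
  by move=> By; apply: (By ord_max).
have BI y : product_base D y ->
    I y = f (y ord0) * compl f (y ord_max).
  by move=> By; rewrite fix0 ?fix1 //; [apply: B1|apply: B0].
have IT y : product_base D y -> T (I y).
  move=> By; have [[x0 _ e0] [x1 _ e1]] := (B0 _ By, B1 _ By).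
  by exists (I y) => //; rewrite /I eM -e0 -e1 ef eg.
have IM : {in product_base D &, {morph I : x y / x * y}}.
  move=> x y /set_mem Bx /set_mem By; rewrite /I !ffunE -!mulgA.
  congr (_ * _); rewrite !mulgA; congr (_ * _).
  by rewrite -(fix0 _ (B0 _ By)) -(fix1 _ (B1 _ Bx)); apply: (np_comm nf).
have IMor : Mor (direct_product D) (full F T) I.
  apply: Mor_intro_product => // P Q phi sP sQ PB QB Dphi PQ.
  have [[_ _ F0] [_ _ F1]] := (Dphi ord0, Dphi ord_max).
  have [th Fth thE] := np_fmor nf (fmor_Hom F_fusion F_base F0)
    (fmor_Hom F_fusion F_base F1).
  have sI R : subgroup R -> R `<=` product_base D -> subgroup (I @` R).
    move=> sR RB; apply: subgroup_image => // x y Rx Ry.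
    by apply: IM; apply/mem_set/RB/set_mem.
  have IE y : P y -> th (I y) = I (prod_map phi y).
    move=> Py; rewrite BI; last exact: PB.
    rewrite thE; [|by exists y|by exists y].
    by rewrite BI ?ffunE //; apply/QB/PQ.
  exists th => //; split; try by move=> _ [y Ry <-]; apply: IT; auto.
  apply/(HomE F_fusion F_base); split; [|exact: sI|].
    apply: (fmor_sub F_fusion F_base Fth); first exact: sI.
    move=> _ [y Py <-]; rewrite BI; last exact: PB.
    exists (f (y ord0)); first by exists (y ord0) => //; exists y.
    by exists (compl f (y ord_max)) => //; exists (y ord_max) => //; exists y.
  move=> _ [y Py <-]; rewrite IE //.
  by exists (prod_map phi y) => //; apply: PQ.
have JM : {morph J : x y / x * y}.
  by move=> x y; apply/ffunP => i; rewrite !ffunE; case: ifP => _.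
have JB x : product_base D (J x).
  by move=> i; case: (ord2P i) => ->; rewrite ?J0 ?J1; exists x.
have prJ i P : pr i (J @` P) = (fun x => J x i) @` P.
  apply/seteqP; split=> [_ [_ [x Px <-] <-]|_ [x Px <-]]; first by exists x.
  by exists (J x) => //; exists x.
have JMor : Mor (full F T) (direct_product D) J.
  apply: Mor_intro_fusion.
  - by apply: (subsystem_full F_fusion F_base (subgroup_range eM)).1.
  - by split=> [x _|x y _ _] //=; apply: JB.
  move=> P Q phi [PT QT Fphi]; have Fp := fmor_Hom F_fusion F_base Fphi.
  have [sP sQ] := Hom_subgroup F_fusion Fphi.
  have [t0 Ft0 t0E] := normal_hat F_fusion F_base nf Fp.
  have [t1 Ft1 t1E] := normal_hat F_fusion F_base ng Fp.
  pose t (i : 'I_2) := if i == ord0 then t0 else t1.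
  have tE x : P x -> prod_map t (J x) = J (phi x).
    move=> Px; apply/ffunP => i; rewrite !ffunE /t.
    by case: eqP => _; [apply: t0E|apply: t1E].
  have PQ x : P x -> Q (phi x) by apply: Hom_fun Fphi.
  exists (prod_map t) => //; split.
    by split; try (by move=> _ [x _ <-]); apply: subgroup_image => // x y _ _.
  exists t; split=> [i||] //; last first.
    by move=> _ [x Px <-]; rewrite tE //; exists (phi x); auto.
  rewrite !prJ; have hom h r : {morph h : x y / x * y} -> fmor F (h @` P) r ->
      (forall x, P x -> r (h x) = h (phi x)) -> Hom F (h @` P) (h @` Q) r.
    move=> hM Fr rE; apply/(HomE F_fusion F_base); split=> //.
      by apply: subgroup_image => //; apply: morph_morph_on.
    by move=> _ [x Px <-]; rewrite rE //; exists (phi x); auto.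
  case: (ord2P i) => ->; rewrite /t /=.
    have JE R : (fun x => J x ord0) @` R = f @` R.
      by congr image; apply: funext.
    by rewrite !JE; split; [move=> _ [x _ <-]; exists x..|apply: hom].
  have JE R : (fun x => J x ord_max) @` R = g @` R.
    by congr image; apply: funext.
  by rewrite !JE; split; [move=> _ [x _ <-]; exists x..|apply: hom].
exists I; first split=> //.
  move=> i x /set_mem; rewrite /I !ffunE.
  by case: (ord2P i) => -> _ /=; rewrite ?mulg1 ?mul1g.
split=> //; exists J => //; split.
  move=> y /set_mem By; apply/ffunP => i.
  have [[x0 _ e0] [x1 _ e1]] := (B0 _ By, B1 _ By).
  case: (ord2P i) => ->; rewrite ?J0 ?J1 /I.
    by rewrite fM -e0 -e1 ff fg mulg1.
  by rewrite gM -e0 -e1 gf gg mul1g.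
by move=> x /set_mem[y _ <-]; rewrite /I J0 J1 fgE ee.
Qed.

(** A nontrivial idempotent [f] below [e] and different from [e] would split the
    image of [e] into the images of [f] and of [(1 - f) e], both proper. *)
Lemma indecomposable_primitive e :
  normal_endo F Omega e -> (forall x, e (e x) = e x) ->
  Omega_indecomposable Omega (full F (range e)) ->
  primitive (normal_endo F Omega) e.
Proof.
move=> ne ee [_ nontriv indec].
have eM := np_morphl ne.
split=> //.
  apply: contrapT => nex; apply: nontriv; apply/seteqP.
  split=> [_ [x _ <-]|_ ->] /=.
    by apply: contrapT => ex; case: nex; exists x.
  by exists 1; rewrite ?(morph1 eM).
move=> f nf ff ef fe; have [fM f'M fE fC _ _ _] := nf.
apply: contrapT => /not_orP[f1 fne]; apply: indec.
pose g := compl f \o e.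
have ng : normal_endo F Omega g.
  by apply: normal_comp => //; [exact: Omega_morph|exact: normal_compl].
have gM := np_morphl ng.
have fg x : f (g x) = 1.
  by rewrite /g /= /compl fM (morphV fM) ff mulVg.
have gE x : e x = f x * g x by rewrite /g /= -(fe x) fE.
have eg x : e (g x) = g x by rewrite /g /= /compl eM (morphV eM) ef ee.
have gf x : g (f x) = 1 by rewrite /g /= ef /compl ff mulVg.
have gg x : g (g x) = g x.
  by rewrite {1}/g /= eg /compl fg invg1 mul1g.
have fge x : g x = compl f (e x) by [].
have rf : range f `<=` range e by move=> _ [x _ <-]; exists (f x).
have rg : range g `<=` range e by move=> _ [x _ <-]; exists (g x).
exists (full F (range f)), (full F (range g)); split.
- split; first by apply: subsystem_full_full => //; apply: subgroup_range.
  move=> /(congr1 (@base S)) /= er; apply: fne => x.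
  have [y _ ey] : range f (e x) by rewrite er; exists x.
  by rewrite -fe -ey ff.
- exact: Omega_invariant_full.
- split; first by apply: subsystem_full_full => //; apply: subgroup_range.
  move=> /(congr1 (@base S)) /= er; apply: f1 => x.
  have [y _ ey] : range g (e x) by rewrite er; exists x.
  by rewrite -fe -ey fg.
- exact: Omega_invariant_full.
- exact: full_is_direct_product.
Qed.

End Indecomposable.

(** * Summability of normal automorphisms *)

Section ImageSubsystem.
Variables (S : groupType) (F : system S).
Hypothesis F_fusion : fusion_system F.
Hypothesis F_base : base F = [set: S].
Implicit Types (P Q : set S) (D : system S) (f a b : S -> S).

Lemma subsystems_above_self f : End F f -> subsystems_above F F f F.
Proof.
move=> Ff; split; first by split=> //; split=> [|P Q]; apply: subset_refl.
split=> [x _|_ _ psi [P [Q [phi [Fphi -> -> e]]]]]; first by rewrite F_base.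
have [psi' Fpsi' psiE] := Mor_hat Ff Fphi.
apply: (fusion_ext F_fusion Fpsi') => _ /set_mem[x Px <-].
by rewrite psiE // e //; apply: mem_set.
Qed.

Lemma Im_contained f D : subsystems_above F F f D -> contained (Im F F f) D.
Proof. by move=> DF; split=> [x Ix|P Q phi Ix]; apply: Ix. Qed.

(** An intersection of subsystems is a subsystem because the factorization of a
    morphism through its image is the same in all of them. *)
Lemma subsystem_Im f : End F f -> subsystem (Im F F f) F.
Proof.
move=> Ff; have FF := subsystems_above_self Ff.
have FI P Q phi : Hom (Im F F f) P Q phi -> Hom F P Q phi.
  by move=> Iphi; apply: Iphi.
split; last exact: Im_contained.
have obj P Q phi : Hom (Im F F f) P Q phi ->
    object (Im F F f) P /\ object (Im F F f) Q.
  move=> Iphi; have [sP sQ] := Hom_subgroup F_fusion (FI _ _ _ Iphi).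
  split; split=> // x Px D DF.
    by have [[_ PD] _] := fusion_object DF.1.1 (Iphi D DF); apply: PD.
  by have [_ [_ QD]] := fusion_object DF.1.1 (Iphi D DF); apply: QD.
split=> //.
- apply/subgroupP; split=> [D DF|x y Ix Iy D DF].
    exact: subgroup1 (fusion_base DF.1.1).
  have sD := fusion_base DF.1.1.
  by apply: subgroupM => //; [apply: Ix|apply: subgroupV => //; apply: Iy].
- move=> P Q phi psi Iphi e D DF.
  exact: (fusion_ext DF.1.1 (Iphi D DF) e).
- move=> P Q R phi psi Iphi Ipsi D DF.
  exact: (fusion_comp DF.1.1 (Iphi D DF) (Ipsi D DF)).
- move=> P Q [sP PI] [sQ QI] phi [PQ [g Ig e]] D DF.
  apply: (fusion_conj DF.1.1).
  + by split=> // x /PI; apply.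
  + by split=> // x /QI; apply.
  + by split=> //; exists g => //; apply: Ig.
- by move=> P Q phi /FI /(fusion_inj F_fusion).
move=> P Q phi Iphi; have Fphi := FI _ _ _ Iphi.
have [R RQ isoR] := fusion_factor F_fusion Fphi.
have eR := Iso_image F_fusion isoR.
have [FphiR [psi Fpsi psiK]] := isoR.
have isoD D : subsystems_above F F f D -> Hom D P R phi /\ Hom D R P psi.
  move=> DF; have fD := DF.1.1.
  have [R' _ isoR'] := fusion_factor fD (Iphi D DF).
  have eR' : R = R' by rewrite -eR (Iso_image fD isoR').
  case: isoR'; rewrite -eR' => Dphi [psi' Dpsi' [psi'K _]]; split=> //.
  apply: (fusion_ext fD Dpsi') => y; rewrite -eR => /set_mem[x Px <-].
  by rewrite psi'K ?psiK.1 //; apply: mem_set.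
exists R => //; split; first by move=> D /isoD[].
by exists psi => // D /isoD[].
Qed.

End ImageSubsystem.

Section NormalAutomorphisms.
Variables (S : groupType) (F : system S) (Omega : set (S -> S)).
Hypothesis F_fusion : fusion_system F.
Hypothesis F_base : base F = [set: S].
Hypothesis Omega_sub : Aut_subgroup F Omega.
Implicit Types (P Q : set S) (a b f c : S -> S).

(** The fusion system of an abelian group [Z] over itself *)
Definition central_system (Z : set S) : system S :=
  System Z (fun P Q => [set phi | [/\ subgroup P, subgroup Q, P `<=` Q, Q `<=` Z
                                    & forall x, P x -> phi x = x]]).

Lemma subsystem_central Z : subgroup Z -> (forall x y, Z x -> commute x y) ->
  subsystem (central_system Z) F.
Proof.
move=> sZ cZ; split; last first.
  split=> [x _|P Q phi [sP sQ PQ QZ e]]; first by rewrite F_base.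
  apply: (fusion_ext F_fusion (Hom_incl F_fusion _ _ PQ)).
  - by apply/(objectE F_base).
  - by apply/(objectE F_base).
  - by move=> x /set_mem /e.
split=> //.
- move=> P Q phi [sP sQ PQ QZ e]; split; split=> //.
  exact: subset_trans QZ.
- move=> P Q phi psi [sP sQ PQ QZ e] e'; split=> // x Px.
  by rewrite -e' ?e //; apply: mem_set.
- move=> P Q R phi psi [sP sQ PQ QZ e] [_ sR QR RZ e']; split=> //.
    exact: subset_trans QR.
  by move=> x Px; rewrite /= e // e' //; apply: PQ.
- move=> P Q [sP PZ] [sQ QZ] phi [PQ [g Zg e]].
  have phiE x : P x -> phi x = x.
    move=> Px; rewrite e; last exact: mem_set.
    by rewrite /cg (cZ g x Zg) mulgK.
  by split=> // x Px; rewrite -(phiE x Px); apply: PQ.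
- move=> P Q phi [sP sQ PQ QZ e]; split; last first.
    by move=> x y /set_mem Px /set_mem Py; rewrite !e.
  split=> [x Px|x y /set_mem Px /set_mem Py]; first by rewrite e //; apply: PQ.
  by rewrite !e //; apply: subgroupM.
move=> P Q phi [sP sQ PQ QZ e]; exists P => //.
have PZ := subset_trans PQ QZ.
split; first by split.
exists phi; first by split.
by split=> x /set_mem Px; rewrite !e.
Qed.

Section Bijective.
Variables a b : S -> S.
Hypotheses (na : normal_endo F Omega a) (nb : normal_endo F Omega b).
Hypotheses (aK : cancel a b) (bK : cancel b a).

Lemma compl_central x y : commute (compl a x) y.
Proof. by rewrite -(bK y); apply/commute_sym/(np_comm na). Qed.

(** Combine the identity of the whole group with [phi]: as [a] is onto, the
    resulting morphism is the identity. *)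
Lemma compl_fmor P phi x : fmor F P phi -> P x -> compl a (phi x) = compl a x.
Proof.
move=> Fphi Px; have sP := fmor_subgroup F_fusion Fphi.
have FT := fmor_id F_fusion F_base (subgroup_setT S).
have [th Fth thE] := np_fmor na FT Fphi.
have a1 := morph1 (np_morphl na); have c1 := morph1 (np_morphr na).
have thid y : th y = y.
  have := thE (b y) 1 I (subgroup1 sP).
  by rewrite (fmor1 F_fusion Fphi) c1 !mulg1 /= bK.
by have := thE 1 x I Px; rewrite thid a1 !mul1g => ->.
Qed.

(** The subsystem [Im (compl a)] has only inclusions as morphisms, by
    [compl_fmor]. So a morphism of the product of the two image subsystems is a
    morphism of [F] on the first coordinate and the identity on the second; it
    is handled by [np_fmor], applied to its transport by [b] and to the identity
    of [S]. *)
Lemma normal_summable : summable F a (compl a).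
Proof.
have Omega_mor := Omega_morph F_fusion F_base Omega_sub.
have nc : normal_endo F Omega (compl a) by apply: normal_compl.
have End_normal f : normal_endo F Omega f -> End F f.
  move=> nf; apply: functorial_End => //; first exact: np_morphl nf.
  by move=> P phi; apply: normal_hat nf.
split; [exact: End_normal|exact: End_normal|].
set D := tnth _; pose Z := range (compl a).
have sZ : subgroup Z.
  exact/subgroup_range/np_morphl/nc.
have cZ x y : Z x -> commute x y by case=> z _ <-; apply: compl_central.
have above : subsystems_above F F (compl a) (central_system Z).
  split; first exact: subsystem_central.
  split=> [_ [x _ <-]|_ _ psi [P [Q [phi [Fphi -> -> e]]]]]; first by exists x.
  have Fp := fmor_Hom F_fusion F_base Fphi.
  have [sP sQ] := Hom_subgroup F_fusion Fphi.
  have cphi x : P x -> compl a (phi x) = compl a x by apply: compl_fmor Fp.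
  split.
  - exact/subgroup_image/morph_morph_on/np_morphl/nc.
  - exact/subgroup_image/morph_morph_on/np_morphl/nc.
  - move=> _ [x Px <-]; rewrite -cphi //; exists (phi x) => //.
    exact: Hom_fun Fphi Px.
  - by move=> _ [x _ <-]; exists x.
  - by move=> _ [x Px <-]; rewrite e ?cphi //; apply: mem_set.
have [ImZ ImZH] := Im_contained above.
have Dsub i : subsystem (D i) F.
  by case: (ord2P i) => ->; apply: subsystem_Im => //; apply: End_normal.
pose I (y : {ffun 'I_2 -> S}) := y ord0 * y ord_max.
have B1 y : product_base D y -> Z (y ord_max).
  by move=> By; apply: ImZ; apply: (By ord_max).
have IM : {in product_base D &, {morph I : x y / x * y}}.
  move=> x y /set_mem Bx /set_mem By; rewrite /I !ffunE -!mulgA.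
  congr (_ * _); rewrite !mulgA; congr (_ * _).
  exact/esym/cZ/B1.
exists I; split=> //.
  apply: Mor_intro_product => [i||P Q phi sP sQ PB QB Dphi PQ].
  - exact: (Dsub i).1.
  - by split=> // y _; rewrite F_base.
  have F0 : Hom F (pr ord0 P) (pr ord0 Q) (phi ord0) by apply: (Dsub ord0).2.2.
  have [_ _ _ _ phi1] : Hom (central_system Z) (pr ord_max P) (pr ord_max Q)
      (phi ord_max) by apply: ImZH; apply: (Dphi ord_max).
  have [phi0 Fphi0 phi0E] := normal_hat F_fusion F_base nb
    (fmor_Hom F_fusion F_base F0).
  have FT := fmor_id F_fusion F_base (subgroup_setT S).
  have [th Fth thE] := np_fmor na Fphi0 FT.
  have IP y : P y -> exists z, [/\ I y = a (b (y ord0)) * compl a z,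
      pr ord0 P (y ord0) & th (I y) = I (prod_map phi y)].
    move=> Py; have [z _ ez] := B1 _ (PB _ Py); exists z.
    have P0 : pr ord0 P (y ord0) by exists y.
    have Iy : I y = a (b (y ord0)) * compl a z by rewrite bK ez.
    have bP0 : (b @` pr ord0 P) (b (y ord0)) by exists (y ord0).
    split=> //; rewrite Iy thE // phi0E // bK ez /I !ffunE phi1 //.
    by exists y.
  have sI R : subgroup R -> R `<=` product_base D -> subgroup (I @` R).
    move=> sR RB; apply: subgroup_image => // x y Rx Ry.
    by apply: IM; apply/mem_set/RB/set_mem.
  exists th; last by move=> y /IP[z []].
  apply/(HomE F_fusion F_base); split; [|exact: sI|].
    apply: (fmor_sub F_fusion F_base Fth); first exact: sI.
    move=> _ [y /IP[z [-> P0 _]] <-]; exists (a (b (y ord0))).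
      by exists (b (y ord0)) => //; exists (y ord0).
    by exists (compl a z) => //; exists z.
  move=> _ [y Py <-]; have [z [_ _ ->]] := IP _ Py.
  by exists (prod_map phi y) => //; apply: PQ.
move=> i x _; rewrite /I !ffunE.
by case: (ord2P i) => -> /=; rewrite ?mulg1 ?mul1g.
Qed.

Lemma normal_Aut_Omega : Aut_Omega Omega F a.
Proof.
have [Ea Ec _] := normal_summable.
split.
- split=> //; exists b; last by split=> x _.
  apply: functorial_End => //; first exact: np_morphl nb.
  by move=> P phi; apply: normal_hat nb.
- split=> //; exists (compl a); split=> //; first exact: normal_summable.
  by move=> x _; apply: mul_compl.
by move=> w Ow x _; apply/esym/(np_equivl na).
Qed.

End Bijective.

End NormalAutomorphisms.

(** * Uniqueness of decompositions of fusion systems *)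

Theorem theorem5p2 (p : nat) (S : groupType) (F : system S)
    (Omega : set (S -> S)) (k m : nat)
    (E : 'I_k -> system S) (E' : 'I_m -> system S)
    (p_prime : prime p)
    (S_toral : discrete_p_toral p S)
    (F_fusion : fusion_system F)
    (F_base : base F = [set: S])
    (F_sat : saturated p F)
    (Omega_sub : Aut_subgroup F Omega)
    (E_sub : forall i, subsystem (E i) F)
    (E_indec : forall i, Omega_indecomposable Omega (E i))
    (E'_sub : forall j, subsystem (E' j) F)
    (E'_indec : forall j, Omega_indecomposable Omega (E' j))
    (E_prod : is_direct_product F E)
    (E'_prod : is_direct_product F E') :
  exists eq_km : k = m,
  exists alpha : S -> S, Aut_Omega Omega F alpha /\
  exists sigma : 'S_k,
    forall i, hat_image alpha (E i) = E' (cast_ord eq_km (sigma i)).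
Proof.
have Omega_mor := Omega_morph F_fusion F_base Omega_sub.
have invariant_base r (D : 'I_r -> system S) :
    (forall i, Omega_indecomposable Omega (D i)) ->
    forall w i, Omega w -> w @` base (D i) = base (D i).
  move=> indec w i Ow; have [inv _ _] := indec i.
  by have /(congr1 (@base S)) := inv w Ow.
have [d [dec_d d_range dE]] := product_idempotents F_fusion F_base E_sub E_prod
  Omega_mor (invariant_base _ _ E_indec).
have [e [dec_e e_range eE]] := product_idempotents F_fusion F_base E'_sub
  E'_prod Omega_mor (invariant_base _ _ E'_indec).
have prim r (D : 'I_r -> system S) (u : 'I_r -> S -> S) :
    (forall i, Omega_indecomposable Omega (D i)) ->
    decomposition (normal_endo F Omega) u ->
    (forall i, range (u i) = base (D i)) ->
    (forall i, D i = full F (base (D i))) ->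
    forall i, primitive (normal_endo F Omega) (u i).
  move=> indec dec_u u_range DE i; apply: indecomposable_primitive => //.
  - exact: dec_N dec_u i.
  - exact: dec_idem dec_u i.
  - by rewrite u_range -DE.
have [a [b [s [[na nb] aK bK [t sK tK] aE]]]] :
    exists a b (s : 'I_k -> 'I_m),
      [/\ normal_endo F Omega a /\ normal_endo F Omega b, cancel a b,
          cancel b a, bijective s
        & forall i, a @` range (d i) = range (e (s i))].
  apply: (krull_remak_schmidt (N := normal_endo F Omega)) => //.
  - by move=> f /np_morphl.
  - by move=> f x y /np_comm.
  - by move=> f; apply: normal_compl.
  - by move=> f g; apply: normal_comp.
  - exact: normal_id.
  - move=> f; apply: normal_drazin => //; first exact: F_sat.2.
      exact: toral_torsion S_toral.
    exact: finite_center_torsion S_toral.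
  - exact: prim.
  - exact: prim.
have eq_km : k = m.
  by have := bij_eq_card (Bijective sK tK); rewrite !card_ord.
exists eq_km, a; split; first exact: normal_Aut_Omega nb aK bK.
have s_inj : injective (fun i => cast_ord (esym eq_km) (s i)).
  by move=> i j /cast_ord_inj /(can_inj sK).
exists (perm s_inj) => i; rewrite permE cast_ordKV dE eE -e_range -aE -d_range.
have fun_normal f : normal_endo F Omega f -> functorial F f.
  by move=> nf P phi; apply: normal_hat nf.
apply: (hat_image_full F_fusion F_base (b := b)) => //.
- exact: np_morphl na.
- exact: np_morphl nb.
- exact: fun_normal.
- exact: fun_normal.
Qed.
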